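(* Let $\mathbb{K}$ be an algebraically closed field of characteristic $0$. The tangent bundle $T_{\mathbb{P}^{1|1}}$ of the projective superspace $\mathbb{P}^{1|1}$ over $\mathbb{K}$ (a supervector bundle of rank $1|1$) does not split as a direct sum of line bundles; that is, it is not isomorphic to a direct sum of even line bundles (rank $1|0$) and odd line bundles (rank $0|1$).
   Context: $\mathbb{P}^{1|1}$ is the projective superspectrum of the free polynomial superalgebra $\mathbb{B}=\mathbb{K}[x_0,x_1,\theta]$, with $x_0,x_1$ even and $\theta$ odd, all of $\mathbb{Z}$-degree $1$. Its underlying scheme is $\mathbb{P}^1$, and $\mathcal{O}_{\mathbb{P}^{1|1}}=\bigwedge\mathcal{O}_{\mathbb{P}^1}(-1)=\mathcal{O}_{\mathbb{P}^1}\oplus\Pi\mathcal{O}_{\mathbb{P}^1}(-1)$, where $\Pi$ is the parity-reversing functor on $\mathbb{Z}_2$-graded modules. A supervector bundle of rank $p|q$ is a $\mathbb{Z}_2$-graded $\mathcal{O}_{\mathbb{P}^{1|1}}$-module locally isomorphic to $\mathcal{O}_{\mathbb{P}^{1|1}}^{\oplus p}\oplus(\Pi\mathcal{O}_{\mathbb{P}^{1|1}})^{\oplus q}$. An even line bundle is a supervector bundle of rank $1|0$, and an odd line bundle is one of rank $0|1$ (that is, $\Pi$ of an even line bundle). The tangent bundle $T_{\mathbb{P}^{1|1}}$ is the sheaf of ($\mathbb{Z}_2$-graded) $\mathbb{K}$-linear superderivations of $\mathcal{O}_{\mathbb{P}^{1|1}}$. It fits in the Euler exact sequence $0 \to \mathcal{O}_{\mathbb{P}^{1|1}}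 \to \mathbb{K}^{2|1}\otimes \mathcal{O}_{\mathbb{P}^{1|1}}(1) \to T_{\mathbb{P}^{1|1}} \to 0$, where $\mathcal{O}_{\mathbb{P}^{1|1}}(r)$ is the rank $1|0$ sheaf associated with the shifted graded supermodule $\mathbb{B}[r]$. *)

(* Defs.v *)
From HB Require Import structures.
From mathcomp Require Import all_boot all_order all_algebra.
From mathcomp Require Import mpoly.
From mathcomp Require Import all_classical.
From mathcomp Require Import topology_structure.

Set Implicit Arguments.
Unset Strict Implicit.
Unset Printing Implicit Defensive.

Import GRing.Theory.

Local Open Scope classical_set_scope.
Local Open Scope ring_scope.

Record opens (X : topologicalType) :=
  Opens { oset :> set X; opensP : open oset }.

Definition opensT (X : topologicalType) : opens X := Opens (@openT X).

Definition opensI (X : topologicalType) (U V : opens X) : opens X :=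
  Opens (openI (opensP U) (opensP V)).

Section Sheaf.
Variables (X : topologicalType) (F : opens X -> Type).
Variable r : forall U V : opens X, V `<=` U -> F U -> F V.

Definition is_presheaf : Prop :=
  (forall (U : opens X) (UU : U `<=` U) (s : F U), r UU s = s) /\
  (forall (U V W : opens X) (VU : V `<=` U) (WV : W `<=` V) (WU : W `<=` U)
     (s : F U), r WV (r VU s) = r WU s).

Definition is_sheaf : Prop :=
  forall (I : Type) (W : I -> opens X) (U : opens X)
    (WU : forall i, W i `<=` U), U `<=` \bigcup_i W i ->
  forall s : forall i, F (W i),
  (forall i j (V : opens X) (Vi : V `<=` W i) (Vj : V `<=` W j),
     r Vi (s i) = r Vj (s j)) ->
  exists! t : F U, forall i, r (WU i) t = s i.

End Sheaf.

(* A Z_2-grading M = M_0 (+) M_1, given by its two projections.  Parities are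
   booleans, false for even and true for odd, added by addb. *)

Record grading (M : zmodType) := Grading {
  part : bool -> M -> M;
  partD : forall i (x y : M), part i (x + y) = part i x + part i y;
  part_sum : forall x : M, part false x + part true x = x;
  part_part : forall i j (x : M),
    part i (part j x) = if i == j then part j x else 0 }.

Definition pure (M : zmodType) (g : grading M) (i : bool) (x : M) : Prop :=
  part g i x = x.

(* Spaces with a sheaf of supercommutative K-superalgebras.  The sections over
   the empty set form the zero ring, hence pzRingType; the K-algebra structure
   is therefore given by the structural morphisms scst. *)

Record superSpace (K : fieldType) := SuperSpace {
  pts :> topologicalType;
  sec : opens pts -> pzRingType;
  scst : forall U, {rmorphism K -> sec U};
  sgr : forall U, grading (sec U);
  res : forall U V : opens pts, V `<=` U -> {rmorphism sec U -> sec V};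
  scst_even : forall U k, pure (sgr U) false (scst U k);
  sec_mul : forall U i j (a b : sec U), pure (sgr U) i a ->
    pure (sgr U) j b -> pure (sgr U) (i (+) j) (a * b);
  sec_comm : forall U i j (a b : sec U), pure (sgr U) i a ->
    pure (sgr U) j b -> a * b = (-1) ^+ (i && j) * (b * a);
  res_scst : forall (U V : opens _) (VU : V `<=` U) k, res VU (scst U k) = scst V k;
  res_part : forall (U V : opens _) (VU : V `<=` U) i a,
    part (sgr V) i (res VU a) = res VU (part (sgr U) i a);
  sec_presheaf : is_presheaf (fun (U V : opens pts) (VU : V `<=` U) => res VU : _ -> _);
  sec_sheaf : is_sheaf (fun (U V : opens pts) (VU : V `<=` U) => res VU : _ -> _) }.

Record superMod (K : fieldType) (X : superSpace K) := SuperMod {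
  msec : forall U : opens X, lmodType (sec U);
  mgr : forall U, grading (msec U);
  mres : forall U V : opens X, V `<=` U -> msec U -> msec V;
  mresD : forall (U V : opens _) (VU : V `<=` U) (m n : msec U),
    mres VU (m + n) = mres VU m + mres VU n;
  mresZ : forall (U V : opens _) (VU : V `<=` U) (a : sec U) (m : msec U),
    mres VU (a *: m) = res VU a *: mres VU m;
  mres_part : forall (U V : opens _) (VU : V `<=` U) i (m : msec U),
    part (mgr V) i (mres VU m) = mres VU (part (mgr U) i m);
  mscale : forall U i j (a : sec U) (m : msec U), pure (sgr U) i a ->
    pure (mgr U) j m -> pure (mgr U) (i (+) j) (a *: m);
  mod_presheaf : is_presheaf mres;
  mod_sheaf : is_sheaf mres }.

Definition iso_on (K : fieldType) (X : superSpace K) (W : opens X)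
    (F G : superMod X) : Prop :=
  exists f : forall V : opens X, V `<=` W -> msec F V -> msec G V,
  [/\ forall (V : opens X) (VW : V `<=` W) a m n,
        f V VW (a *: m + n) = a *: f V VW m + f V VW n,
      forall (V : opens X) (VW : V `<=` W) i m,
        f V VW (part (mgr F V) i m) = part (mgr G V) i (f V VW m),
      forall (U V : opens X) (UW : U `<=` W) (VW : V `<=` W) (VU : V `<=` U) m,
        f V VW (mres VU m) = mres VU (f U UW m) &
      forall (V : opens X) (VW : V `<=` W), bijective (f V VW)].

Definition iso_mod (K : fieldType) (X : superSpace K) (F G : superMod X) :=
  iso_on (opensT X) F G.

Section Grading.
Variables (M : zmodType) (g : grading M).

Lemma part0 i : part g i 0 = 0.
Proof. by apply: (addrI (part g i 0)); rewrite -partD !addr0. Qed.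

Lemma partN i x : part g i (- x) = - part g i x.
Proof. by apply: (addrI (part g i x)); rewrite -partD !subrr part0. Qed.

Lemma pure_part i x : pure g i (part g i x).
Proof. by rewrite /pure part_part eqxx. Qed.

Lemma pureD i x y : pure g i x -> pure g i y -> pure g i (x + y).
Proof. by rewrite /pure partD => -> ->. Qed.

Lemma pureN i x : pure g i x -> pure g i (- x).
Proof. by rewrite /pure partN => ->. Qed.

Lemma part_pure i j x : pure g j x -> part g i x = if i == j then x else 0.
Proof. by move=> <-; rewrite part_part. Qed.

End Grading.

(* Parity reversal.  The O_X-action is left unchanged; twisting it by
   (-1)^|a| gives an isomorphic graded module, through m |-> (-1)^|m| m. *)

Section Pi.
Variables (K : fieldType) (X : superSpace K) (F : superMod X).

Definition pi_grading (M : zmodType) (g : grading M) : grading M.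
Proof.
refine (@Grading M (fun i => part g (~~ i)) _ _ _).
- by move=> i x y; rewrite partD.
- by move=> x; rewrite addrC part_sum.
- by move=> i j x; rewrite part_part; case: i j => -[].
Defined.

Lemma pure_pi (M : zmodType) (g : grading M) i x :
  pure (pi_grading g) i x <-> pure g (~~ i) x.
Proof. by []. Qed.

Definition pi_mod : superMod X.
Proof.
refine (@SuperMod K X (msec F) (fun U => pi_grading (mgr F U))
          (@mres K X F) _ _ _ _ _ _).
- exact: mresD.
- exact: mresZ.
- by move=> U V VU i m /=; rewrite mres_part.
- move=> U i j a m ai /pure_pi mj; apply/pure_pi.
  by rewrite -addbN; apply: mscale.
- exact: mod_presheaf.
- exact: mod_sheaf.
Defined.

End Pi.

Definition str_mod (K : fieldType) (X : superSpace K) : superMod X.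
Proof.
refine (@SuperMod K X (fun U => (sec U)^o) (fun U => sgr U)
          (fun U V VU => res VU) _ _ _ _ _ _).
- by move=> U V VU m n; rewrite raddfD.
- by move=> U V VU a m; rewrite /GRing.scale /= rmorphM.
- by move=> U V VU i m; rewrite res_part.
- by move=> U i j a m; apply: sec_mul.
- exact: sec_presheaf.
- exact: sec_sheaf.
Defined.

Section DirectSum.
Variables (K : fieldType) (X : superSpace K) (I : finType).
Variable F : I -> superMod X.

Definition dsum_sec (U : opens X) : Type := forall i, msec (F i) U.

Section DsumSec.
Variable U : opens X.
Implicit Types s t : dsum_sec U.

HB.instance Definition _ := gen_eqMixin (dsum_sec U).
HB.instance Definition _ := gen_choiceMixin (dsum_sec U).

Definition dsum_add s t : dsum_sec U := fun i => s i + t i.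
Definition dsum_opp s : dsum_sec U := fun i => - s i.
Definition dsum_zero : dsum_sec U := fun i => 0.
Definition dsum_scale (a : sec U) s : dsum_sec U := fun i => a *: s i.

Lemma dsum_addA : associative dsum_add.
Proof. by move=> s t u; apply: functional_extensionality_dep => i; apply: addrA. Qed.
Lemma dsum_addC : commutative dsum_add.
Proof. by move=> s t; apply: functional_extensionality_dep => i; apply: addrC. Qed.
Lemma dsum_add0 : left_id dsum_zero dsum_add.
Proof. by move=> s; apply: functional_extensionality_dep => i; apply: add0r. Qed.
Lemma dsum_addN : left_inverse dsum_zero dsum_opp dsum_add.
Proof. by move=> s; apply: functional_extensionality_dep => i; apply: addNr. Qed.

HB.instance Definition _ := GRing.isZmodule.Build (dsum_sec U)
  dsum_addA dsum_addC dsum_add0 dsum_addN.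

Lemma dsum_scaleA a b s : dsum_scale a (dsum_scale b s) = dsum_scale (a * b) s.
Proof. by apply: functional_extensionality_dep => i; apply: scalerA. Qed.
Lemma dsum_scale1 : left_id 1 dsum_scale.
Proof. by move=> s; apply: functional_extensionality_dep => i; apply: scale1r. Qed.
Lemma dsum_scaleDr : right_distributive dsum_scale +%R.
Proof. by move=> a s t; apply: functional_extensionality_dep => i; apply: scalerDr. Qed.
Lemma dsum_scaleDl s : {morph dsum_scale^~ s : a b / a + b}.
Proof. by move=> a b; apply: functional_extensionality_dep => i; apply: scalerDl. Qed.

HB.instance Definition _ := GRing.Zmodule_isLmodule.Build (sec U) (dsum_sec U)
  dsum_scaleA dsum_scale1 dsum_scaleDr dsum_scaleDl.

Definition dsum_grading : grading (dsum_sec U).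
Proof.
refine (@Grading _ (fun k s i => part (mgr (F i) U) k (s i)) _ _ _).
- by move=> k s t; apply: functional_extensionality_dep => i; apply: partD.
- by move=> s; apply: functional_extensionality_dep => i; apply: part_sum.
- move=> k l s; apply: functional_extensionality_dep => i.
  by rewrite part_part; case: eqP.
Defined.

Lemma pure_dsum k s :
  pure dsum_grading k s <-> forall i, pure (mgr (F i) U) k (s i).
Proof.
split=> [h i|h]; first by rewrite /pure -[RHS](congr1 (fun s => s i) h).
by apply: functional_extensionality_dep => i; apply: h.
Qed.

End DsumSec.

Definition dsum : superMod X.
Proof.
refine (@SuperMod K X (fun U => dsum_sec U) dsum_grading
   (fun U V VU s i => mres VU (s i)) _ _ _ _ _ _).
- by move=> U V VU s t; apply: functional_extensionality_dep => i; apply: mresD.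
- by move=> U V VU a s; apply: functional_extensionality_dep => i; apply: mresZ.
- move=> U V VU k s.
  by apply: functional_extensionality_dep => i; apply: mres_part.
- move=> U k l a s ak /pure_dsum sl; apply/pure_dsum => i.
  exact: mscale.
- split=> [U UU s|U V W VU WV WU s].
    apply: functional_extensionality_dep => i.
    by have [+ _] := mod_presheaf (F i) => ->.
  apply: functional_extensionality_dep => i.
  by have [_] := mod_presheaf (F i) => ->.
- move=> J W U WU cU s sc.
  have glue i : exists! t : msec (F i) U, forall j, mres (WU j) t = s j i.
    apply: mod_sheaf => // j k V Vj Vk.
    exact: (congr1 (fun u => u i) (sc j k V Vj Vk)).
  pose t i := sval (cid (glue i)); have tP i := svalP (cid (glue i)).
  exists t; split=> [j|u uP].
    by apply: functional_extensionality_dep => i; apply: (tP i).1.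
  apply: functional_extensionality_dep => i; apply: (tP i).2 => j.
  by rewrite -uP.
Defined.

End DirectSum.

Section Bundles.
Variables (K : fieldType) (X : superSpace K).

Definition free_mod (p q : nat) : superMod X :=
  dsum (fun i : ('I_p + 'I_q)%type =>
    match i with inl _ => str_mod X | inr _ => pi_mod (str_mod X) end).

Definition is_bundle (p q : nat) (F : superMod X) : Prop :=
  forall x : X, exists2 W : opens X, oset W x & iso_on W F (free_mod p q).

Definition even_line_bundle := is_bundle 1 0.
Definition odd_line_bundle := is_bundle 0 1.

Definition splits_as_line_bundles (F : superMod X) : Prop :=
  exists (p q : nat) (L : 'I_p -> superMod X) (M : 'I_q -> superMod X),
  [/\ forall i, even_line_bundle (L i),
      forall j, odd_line_bundle (M j) &
      iso_mod F (dsum (fun i : ('I_p + 'I_q)%type =>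
        match i with inl i => L i | inr j => M j end))].

End Bundles.

(* A section of the tangent sheaf over U is a K-linear superderivation of the
   sheaf O_X restricted to U: a family of maps O_X(V) -> O_X(V), V in U, that
   commutes with restrictions.  It need not be homogeneous; the sign in the
   Leibniz rule is that of each of its homogeneous components. *)

Section Tangent.
Variables (K : fieldType) (X : superSpace K).

Section Op.
Variable U : opens X.

Definition sec_op : Type :=
  forall V : opens X, V `<=` U -> sec V -> sec V.

Implicit Type D : sec_op.

Definition is_nat_op D : Prop :=
  forall (V W : opens X) (VU : V `<=` U) (WU : W `<=` U) (WV : W `<=` V) a,
    D W WU (res WV a) = res WV (D V VU a).

Definition is_lin_op D : Prop :=
  forall (V : opens X) (VU : V `<=` U) (k : K) a b,
    D V VU (scst V k * a + b) = scst V k * D V VU a + D V VU b.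

Definition is_leibniz (i : bool) D : Prop :=
  forall (V : opens X) (VU : V `<=` U) (j : bool) a b, pure (sgr V) j a ->
    D V VU (a * b) = D V VU a * b + (-1) ^+ (i && j) * (a * D V VU b).

(* The homogeneous component of parity i of D: the part of D that shifts
   parities by i. *)
Definition op_part (i : bool) D : sec_op := fun V VU a =>
    part (sgr V) i (D V VU (part (sgr V) false a))
  + part (sgr V) (~~ i) (D V VU (part (sgr V) true a)).
Arguments op_part i D V VU a : clear implicits.

Definition is_superder D : Prop :=
  [/\ is_nat_op D, is_lin_op D & forall i, is_leibniz i (op_part i D)].

Record superder := Superder { der_op : sec_op; _ : is_superder der_op }.
Arguments der_op _ V VU _ : clear implicits.

Lemma superderP (D : superder) : is_superder (der_op D).
Proof. by case: D. Qed.

Lemma superder_inj : injective der_op.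
Proof.
by move=> [D hD] [E hE] /= DE; subst E; congr Superder; apply: Prop_irrelevance.
Qed.

Lemma op_eq (D E : sec_op) : (forall V VU a, D V VU a = E V VU a) -> D = E.
Proof.
move=> h; apply: functional_extensionality_dep => V.
apply: functional_extensionality_dep => VU.
by apply: functional_extensionality_dep => a; apply: h.
Qed.

HB.instance Definition _ := gen_eqMixin superder.
HB.instance Definition _ := gen_choiceMixin superder.

Lemma lin_op0 D : is_lin_op D ->
  forall (V : opens X) (VU : V `<=` U), D V VU 0 = 0.
Proof.
move=> lD V VU; have := lD V VU 1 0 0.
by rewrite rmorph1 !mul1r addr0 -[X in X = _]addr0 => /addrI.
Qed.

Lemma lin_opD D : is_lin_op D -> forall (V : opens X) (VU : V `<=` U) a b,
  D V VU (a + b) = D V VU a + D V VU b.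
Proof. by move=> lD V VU a b; have := lD V VU 1 a b; rewrite rmorph1 !mul1r. Qed.

Definition op_add D E : sec_op := fun V VU a => D V VU a + E V VU a.
Definition op_opp D : sec_op := fun V VU a => - D V VU a.
Definition op_zero : sec_op := fun V VU a => 0.
Definition op_scale (c : sec U) D : sec_op :=
  fun V VU a => res VU c * D V VU a.
Arguments op_add D E V VU a : clear implicits.
Arguments op_opp D V VU a : clear implicits.
Arguments op_zero V VU a : clear implicits.
Arguments op_scale c D V VU a : clear implicits.

Lemma op_partD i D E : op_part i (op_add D E) = op_add (op_part i D) (op_part i E).
Proof. by apply: op_eq => V VU a; rewrite /op_part /op_add !partD addrACA. Qed.

Lemma op_partN i D : op_part i (op_opp D) = op_opp (op_part i D).
Proof. by apply: op_eq => V VU a; rewrite /op_part /op_opp !partN opprD. Qed.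

Lemma op_part0 i : op_part i op_zero = op_zero.
Proof. by apply: op_eq => V VU a; rewrite /op_part /op_zero !part0 addr0. Qed.

Lemma op_part_sum D : is_lin_op D ->
  op_add (op_part false D) (op_part true D) = D.
Proof.
move=> lD; apply: op_eq => V VU a; rewrite /op_add /op_part /=.
by rewrite addrACA [X in _ + X]addrC !part_sum -lin_opD // part_sum.
Qed.

Lemma op_part_pure i D : forall (V : opens X) (VU : V `<=` U) j a,
  is_lin_op D -> pure (sgr V) j a ->
  op_part i D V VU a = part (sgr V) (i (+) j) (D V VU a).
Proof.
move=> V VU j a lD aj; rewrite /op_part !(part_pure _ aj).
by case: j aj => aj /=; rewrite lin_op0 // part0 ?addr0 ?add0r; case: i.
Qed.

Lemma op_part_part i j D : is_lin_op D ->
  op_part i (op_part j D) = if i == j then op_part j D else op_zero.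
Proof.
move=> lD; apply: op_eq => V VU a.
rewrite {1}/op_part !(op_part_pure _ _ lD (pure_part _ _ _)) !part_part.
case: eqP => [->|].
  by rewrite addbF addbT !eqxx.
by case: i; case: j => //= _; rewrite addr0.
Qed.

Lemma op_part_nat i D : is_nat_op D -> is_nat_op (op_part i D).
Proof.
move=> nD V W VU WU WV a.
by rewrite /op_part !res_part !(nD _ _ VU) !res_part rmorphD.
Qed.

Lemma part_cst (V : opens X) i k a :
  part (sgr V) i (scst V k * a) = scst V k * part (sgr V) i a.
Proof.
have aE := part_sum (sgr V) a.
have h j := sec_mul (scst_even V k) (pure_part (sgr V) j a).
rewrite -{1}aE mulrDr partD !(part_pure _ (h _)).
by case: i => /=; rewrite ?addr0 ?add0r.
Qed.

Lemma op_part_lin i D : is_lin_op D -> is_lin_op (op_part i D).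
Proof.
move=> lD V VU k a b; rewrite /op_part !partD !part_cst !lD !partD !part_cst.
by rewrite mulrDr addrACA.
Qed.

Lemma leibnizD (R : pzRingType) (s a b x y z w : R) :
  x * b + s * (a * z) + (y * b + s * (a * w)) =
  (x + y) * b + s * (a * (z + w)).
Proof. by rewrite mulrDl !mulrDr addrACA. Qed.

Lemma der_part_subproof i (D : superder) : is_superder (op_part i (der_op D)).
Proof.
have [nD lD LD] := superderP D.
split; [exact: op_part_nat | exact: op_part_lin | move=> j].
rewrite op_part_part //; case: eqP => [->|_]; first exact: LD.
by move=> V VU l a b _; rewrite /op_zero mul0r !mulr0 addr0.
Qed.

Definition der_part i (D : superder) := Superder (der_part_subproof i D).

Lemma der_add_subproof (D E : superder) :
  is_superder (op_add (der_op D) (der_op E)).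
Proof.
have [nD lD LD] := superderP D; have [nE lE LE] := superderP E; split.
- by move=> V W VU WU WV a; rewrite /op_add !(nD _ _ VU) !(nE _ _ VU) rmorphD.
- by move=> V VU k a b; rewrite /op_add lD lE mulrDr addrACA.
- move=> i V VU j a b aj; rewrite op_partD /op_add (LD i V VU j a b aj) (LE i V VU j a b aj).
  exact: leibnizD.
Qed.

Lemma der_opp_subproof (D : superder) : is_superder (op_opp (der_op D)).
Proof.
have [nD lD LD] := superderP D; split.
- by move=> V W VU WU WV a; rewrite /op_opp !(nD _ _ VU) rmorphN.
- by move=> V VU k a b; rewrite /op_opp lD mulrN opprD.
- move=> i V VU j a b aj; rewrite op_partN /op_opp (LD i V VU j a b aj).
  by rewrite mulNr !mulrN opprD.
Qed.

Lemma der_zero_subproof : is_superder op_zero.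
Proof.
split.
- by move=> V W VU WU WV a; rewrite /op_zero rmorph0.
- by move=> V VU k a b; rewrite /op_zero mulr0 addr0.
- by move=> i V VU j a b aj; rewrite op_part0 /op_zero mul0r !mulr0 addr0.
Qed.

Definition der_add (D E : superder) := Superder (der_add_subproof D E).
Definition der_opp (D : superder) := Superder (der_opp_subproof D).
Definition der_zero := Superder der_zero_subproof.

Lemma der_addA : associative der_add.
Proof. by move=> D E G; apply/superder_inj/op_eq => V VU a; apply: addrA. Qed.
Lemma der_addC : commutative der_add.
Proof. by move=> D E; apply/superder_inj/op_eq => V VU a; apply: addrC. Qed.
Lemma der_add0 : left_id der_zero der_add.
Proof. by move=> D; apply/superder_inj/op_eq => V VU a; apply: add0r. Qed.
Lemma der_addN : left_inverse der_zero der_opp der_add.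
Proof. by move=> D; apply/superder_inj/op_eq => V VU a; apply: addNr. Qed.

HB.instance Definition _ := GRing.isZmodule.Build superder
  der_addA der_addC der_add0 der_addN.

Lemma op_scale_part i c D :
  op_part i (op_scale c D) =
  op_add (op_scale (part (sgr U) false c) (op_part i D))
         (op_scale (part (sgr U) true c) (op_part (~~ i) D)).
Proof.
apply: op_eq => V VU a; rewrite /op_part /op_scale /op_add negbK -!res_part.
have P (x : sec V) k : part (sgr V) k (res VU c * x) =
    part (sgr V) false (res VU c) * part (sgr V) k x
  + part (sgr V) true (res VU c) * part (sgr V) (~~ k) x.
  move: (res VU c) => d.
  rewrite -{1}(part_sum (sgr V) d) -{1}(part_sum (sgr V) x).
  have h i1 i2 := sec_mul (pure_part (sgr V) i1 d) (pure_part (sgr V) i2 x).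
  rewrite mulrDl !mulrDr !partD !(part_pure _ (h _ _)).
  by case: k => /=; rewrite !(add0r, addr0) // addrC.
by rewrite !P negbK !mulrDr addrACA.
Qed.

Lemma leibniz_scale i k c D : pure (sgr U) k c -> is_leibniz i D ->
  is_leibniz (k (+) i) (op_scale c D).
Proof.
move=> ck LD V VU j a b aj; rewrite /op_scale (LD V VU j a b aj) mulrDr !mulrA.
congr (_ + _); set d := res VU c.
have dk : pure (sgr V) k d by rewrite /pure res_part ck.
have C s (x y : sec V) : x * ((-1) ^+ s * y) = (-1) ^+ s * (x * y).
  by rewrite mulrA (commr_sign x) -mulrA.
rewrite -!mulrA C (mulrA d) (sec_comm dk aj) -!mulrA.
by case: (i); case: (j); case: (k); rewrite /= ?expr0 ?expr1 ?mul1r ?mulN1r ?opprK.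
Qed.

Lemma der_scale_subproof c (D : superder) :
  is_superder (op_scale c (der_op D)).
Proof.
have [nD lD LD] := superderP D; split.
- move=> V W VU WU WV a; rewrite /op_scale (nD _ _ VU) rmorphM.
  by congr (_ * _); rewrite (sec_presheaf X).2.
- move=> V VU k a b; rewrite /op_scale lD mulrDr; congr (_ + _).
  set x := res _ _; set y := der_op _ _ _; rewrite !mulrA; congr (_ * _).
  rewrite -{1}(part_sum (sgr V) x) mulrDl.
  rewrite !(sec_comm (pure_part _ _ _) (scst_even V k)) !andbF !mul1r.
  by rewrite -mulrDr part_sum.
- move=> i V VU j a b aj; rewrite op_scale_part.
  have L0 := leibniz_scale (pure_part (sgr U) false c) (LD i).
  have L1 := leibniz_scale (pure_part (sgr U) true c) (LD (~~ i)).
  rewrite /op_add (L0 V VU j a b aj) (L1 V VU j a b aj) /= negbK.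
  exact: leibnizD.
Qed.

Definition der_scale c (D : superder) := Superder (der_scale_subproof c D).

Lemma der_scaleA c d (D : superder) : der_scale c (der_scale d D) = der_scale (c * d) D.
Proof.
by apply/superder_inj/op_eq => V VU a; rewrite /= /op_scale rmorphM mulrA.
Qed.
Lemma der_scale1 : left_id 1 der_scale.
Proof.
by move=> D; apply/superder_inj/op_eq => V VU a; rewrite /= /op_scale rmorph1 mul1r.
Qed.
Lemma der_scaleDr : right_distributive der_scale +%R.
Proof.
by move=> c D E; apply/superder_inj/op_eq => V VU a; rewrite /= /op_scale mulrDr.
Qed.
Lemma der_scaleDl (D : superder) : {morph der_scale^~ D : c d / c + d}.
Proof.
move=> c d; apply/superder_inj/op_eq => V VU a.
by rewrite /= /op_scale rmorphD mulrDl.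
Qed.

HB.instance Definition _ := GRing.Zmodule_isLmodule.Build (sec U) superder
  der_scaleA der_scale1 der_scaleDr der_scaleDl.

Definition der_grading : grading superder.
Proof.
refine (@Grading _ der_part _ _ _).
- by move=> i D E; apply/superder_inj; apply: op_partD.
- move=> D; apply/superder_inj; apply: op_part_sum.
  by have [] := superderP D.
- move=> i j D; apply/superder_inj => /=.
  by rewrite op_part_part; [case: eqP | have [] := superderP D].
Defined.

End Op.

Arguments op_part {U} i D V VU a.
Arguments der_op {U} _ V VU _.
Arguments op_add {U} D E V VU a.
Arguments op_zero U V VU a : clear implicits.
Arguments op_scale {U} c D V VU a.

Section DerRes.
Variables (U V : opens X) (VU : V `<=` U).

Definition op_res (D : sec_op U) : sec_op V :=
  fun W WV a => D W (subset_trans WV VU) a.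
Arguments op_res D V VU a : clear implicits.

Lemma der_res_subproof (D : superder U) : is_superder (op_res (der_op D)).
Proof.
have [nD lD LD] := superderP D; split.
- by move=> W W' WV W'V W'W a; apply: nD.
- by move=> W WV k a b; apply: lD.
- by move=> i W WV j a b aj; apply: (LD i W _ j).
Qed.

Definition der_res (D : superder U) : superder V :=
  Superder (der_res_subproof D).

End DerRes.

Lemma der_op_irr U (D : superder U) (V : opens X) (h h' : V `<=` U) a :
  der_op D V h a = der_op D V h' a.
Proof. by congr (der_op D V _ a); apply: Prop_irrelevance. Qed.

Lemma der_scale_pure U i j (c : sec U) (D : superder U) :
  pure (sgr U) i c -> pure (der_grading U) j D ->
  pure (der_grading U) (i (+) j) (c *: D).
Proof.
move=> ci Dj; apply/superder_inj; rewrite /= op_scale_part !(part_pure _ ci).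
have {}Dj l : op_part l (der_op D) = if l == j then der_op D else op_zero U.
  by have /= -> := congr1 (@der_op U) (part_pure l Dj); case: eqP.
rewrite !Dj; apply: op_eq => V VU a; rewrite /op_add /op_scale.
by case: i ci; case: j Dj => Dj ci /=; rewrite ?rmorph0 ?mul0r ?mulr0 ?addr0 ?add0r.
Qed.

Lemma res_res (U V W : opens X) (VU : V `<=` U) (WV : W `<=` V) (WU : W `<=` U)
  a : res WV (res VU a) = res WU a.
Proof. exact: (sec_presheaf X).2. Qed.

Lemma res_id (U : opens X) (UU : U `<=` U) a : res UU a = a.
Proof. exact: (sec_presheaf X).1. Qed.

Lemma sec_sep (I : Type) (W : I -> opens X) (U : opens X)
    (WU : forall i, W i `<=` U) : U `<=` \bigcup_i W i ->
  forall a b : sec U, (forall i, res (WU i) a = res (WU i) b) -> a = b.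
Proof.
move=> cU a b ab; have := @sec_sheaf K X I W U WU cU (fun i => res (WU i) b).
case=> [i j V Vi Vj|t [_ tU]].
  have h : V `<=` U := subset_trans Vi (WU i).
  by rewrite (res_res _ _ h) (res_res _ _ h).
by rewrite -(tU a) // -(tU b).
Qed.

Lemma der_sheaf :
  is_sheaf (fun (U V : opens X) (VU : V `<=` U) => der_res VU).
Proof.
move=> I W U WU cU s sc.
pose VW (V : opens X) i := opensI V (W i).
have VWV V i : VW V i `<=` V by apply: subIsetl.
have VWW V i : VW V i `<=` W i by apply: subIsetr.
have cV (V : opens X) : V `<=` U -> V `<=` \bigcup_i VW V i.
  by move=> VU x Vx; have [i _ Wx] := cU x (VU x Vx); exists i.
have sE i j (Z : opens X) (Zi : Z `<=` W i) (Zj : Z `<=` W j) a :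
    der_op (s i) Z Zi a = der_op (s j) Z Zj a.
  have := congr1 (fun D => der_op D Z (@subset_refl _ Z) a) (sc i j Z Zi Zj).
  rewrite /= /op_res => e.
  by rewrite (der_op_irr _ Zi (subset_trans (@subset_refl _ Z) Zi)) e;
     apply: der_op_irr.
have sN i : is_nat_op (der_op (s i)) by case: (superderP (s i)).
have glue (V : opens X) (VU : V `<=` U) a : exists! t : sec V,
    forall i, res (VWV V i) t = der_op (s i) _ (VWW V i) (res (VWV V i) a).
  apply: (sec_sheaf (VWV V)); first exact: cV.
  move=> i j Z Zi Zj.
  have Zi' := subset_trans Zi (VWW V i); have Zj' := subset_trans Zj (VWW V j).
  have ZV := subset_trans Zi (VWV V i).
  rewrite -(sN i _ _ _ Zi') -(sN j _ _ _ Zj') !(res_res _ _ ZV).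
  exact: sE.
pose D : sec_op U := fun V VU a => sval (cid (glue V VU a)).
have DP (V Z : opens X) (VU : V `<=` U) i (ZV : Z `<=` V) (Zi : Z `<=` W i) a :
    res ZV (D V VU a) = der_op (s i) Z Zi (res ZV a).
  have [/(_ i) h _] := svalP (cid (glue V VU a)).
  have ZVW : Z `<=` VW V i by move=> x Zx; split; [apply: ZV | apply: Zi].
  rewrite -(res_res (VWV V i) ZVW ZV) h -(sN i _ _ _ Zi).
  by rewrite (res_res _ _ ZV).
have Dpart k (V Z : opens X) (VU : V `<=` U) i (ZV : Z `<=` V)
    (Zi : Z `<=` W i) a :
    res ZV (op_part k D V VU a) = op_part k (der_op (s i)) Z Zi (res ZV a).
  by rewrite /op_part rmorphD -!res_part !(DP _ _ _ i _ Zi) !res_part.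
have Dder : is_superder D.
  split=> [V Z VU ZU ZV a|V VU k a b|k V VU j a b aj].
  - apply: (@sec_sep _ (VW Z) _ (VWV Z)) => [|i]; first exact: cV.
    have h := subset_trans (VWV Z i) ZV.
    by rewrite (DP _ _ _ i _ (VWW Z i)) !(res_res _ _ h) (DP _ _ _ i _ (VWW Z i)).
  - apply: (@sec_sep _ (VW V) _ (VWV V)) => [|i]; first exact: cV.
    have [_ l _] := superderP (s i).
    by rewrite !(rmorphD, rmorphM) !(DP _ _ _ i _ (VWW V i)) rmorphD rmorphM
      res_scst l.
  - apply: (@sec_sep _ (VW V) _ (VWV V)) => [|i]; first exact: cV.
    have [_ _ /(_ k)L] := superderP (s i).
    rewrite (Dpart _ _ _ _ i (VWV V i) (VWW V i)) rmorphD !rmorphM rmorph_sign.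
    rewrite !(Dpart _ _ _ _ i (VWV V i) (VWW V i)).
    apply: (L _ _ j).
    by rewrite /pure res_part aj.
exists (Superder Dder); split=> [i|E hE].
  apply/superder_inj/op_eq => V VW' a; rewrite /= /op_res.
  have VV : V `<=` V by [].
  by rewrite -[LHS](res_id VV) (DP _ _ _ i _ VW') res_id.
apply/superder_inj/op_eq => V VU a /=.
apply: (@sec_sep _ (VW V) _ (VWV V)) => [|i]; first exact: cV.
rewrite (DP _ _ _ i _ (VWW V i)) -hE /= /op_res.
have [nE _ _] := superderP E; rewrite -(nE _ _ _ (subset_trans (VWV V i) VU)).
exact: der_op_irr.
Qed.

Definition tangent : superMod X.
Proof.
refine (@SuperMod K X (fun U => superder U) der_grading der_res
   _ _ _ _ _ _).
- by move=> U V VU D E; apply: superder_inj.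
- move=> U V VU c D; apply/superder_inj/op_eq => W WV a.
  by congr (_ * _); rewrite (res_res _ _ (subset_trans WV VU)).
- by move=> U V VU i D; apply: superder_inj.
- exact: der_scale_pure.
- split=> [U UU D|U V W VU WV WU D]; apply/superder_inj/op_eq => Z ZU a;
    rewrite /= /op_res; apply: der_op_irr.
- exact: der_sheaf.
Defined.

End Tangent.

(* The Grassmann algebra R[theta] on one odd generator: ev + od theta *)

Record grassmann (R : Type) := Grassmann { ev : R; od : R }.

Section Grassmann.
Variable R : comPzRingType.
Implicit Types a b c : grassmann R.

Definition gr_pair a := (ev a, od a).
Definition pair_gr (p : R * R) := Grassmann p.1 p.2.
Lemma gr_pairK : cancel gr_pair pair_gr. Proof. by case. Qed.

HB.instance Definition _ := Choice.copy (grassmann R) (can_type gr_pairK).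

Definition gr_add a b := Grassmann (ev a + ev b) (od a + od b).
Definition gr_opp a := Grassmann (- ev a) (- od a).
Definition gr_mul a b := Grassmann (ev a * ev b) (ev a * od b + od a * ev b).

Lemma gr_addA : associative gr_add.
Proof. by move=> a b c; rewrite /gr_add /= !addrA. Qed.
Lemma gr_addC : commutative gr_add.
Proof. by move=> a b; rewrite /gr_add addrC [od a + _]addrC. Qed.
Lemma gr_add0 : left_id (Grassmann 0 0) gr_add.
Proof. by case=> x y; rewrite /gr_add /= !add0r. Qed.
Lemma gr_addN : left_inverse (Grassmann 0 0) gr_opp gr_add.
Proof. by case=> x y; rewrite /gr_add /= !addNr. Qed.

HB.instance Definition _ := GRing.isZmodule.Build (grassmann R)
  gr_addA gr_addC gr_add0 gr_addN.

Lemma gr_mulA : associative gr_mul.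
Proof.
by move=> a b c; rewrite /gr_mul /= mulrDr mulrDl !mulrA addrA.
Qed.
Lemma gr_mulC : commutative gr_mul.
Proof.
move=> a b; rewrite /gr_mul [ev a * ev b]mulrC [ev a * od b]mulrC.
by rewrite [od a * ev b]mulrC addrC.
Qed.
Lemma gr_mul1 : left_id (Grassmann 1 0) gr_mul.
Proof. by case=> x y; rewrite /gr_mul /= !mul1r mul0r addr0. Qed.
Lemma gr_mulDl : left_distributive gr_mul gr_add.
Proof.
by move=> a b c; rewrite /gr_mul /gr_add /= !mulrDl addrACA.
Qed.

HB.instance Definition _ := GRing.Zmodule_isComPzRing.Build (grassmann R)
  gr_mulA gr_mulC gr_mul1 gr_mulDl.

Lemma gr_eq a b : ev a = ev b -> od a = od b -> a = b.
Proof. by case: a => ? ?; case: b => ? ? /= -> ->. Qed.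

Lemma grD a b : a + b = Grassmann (ev a + ev b) (od a + od b).
Proof. by []. Qed.
Lemma grN a : - a = Grassmann (- ev a) (- od a).
Proof. by []. Qed.
Lemma grM a b :
  a * b = Grassmann (ev a * ev b) (ev a * od b + od a * ev b).
Proof. by []. Qed.
Lemma gr0 : 0 = Grassmann 0 0 :> grassmann R.
Proof. by []. Qed.
Lemma gr1 : 1 = Grassmann 1 0 :> grassmann R.
Proof. by []. Qed.

Definition gr_part (i : bool) a :=
  if i then Grassmann 0 (od a) else Grassmann (ev a) 0.

End Grassmann.

Section P11.
Variable K : fieldType.

Notation A := {mpoly K[2]}.
Notation F := {fraction A}.

(* B = K[x_0, x_1, theta] = A (+) A theta, and its component of degree n for
   the Z-grading in which x_0, x_1 and theta have degree 1. *)
Notation B := (grassmann A).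

Definition in_deg (n : nat) (f : B) : Prop :=
  ev f \is n.-homog /\ (if n is m.+1 then od f \is m.-homog else od f = 0).

(* The points: theta is nilpotent, so the homogeneous primes of B are those of
   B / (theta) = A. *)
Record projPt := ProjPt {
  hprime :> set A;
  hprime0 : hprime 0;
  hprimeD : forall f g, hprime f -> hprime g -> hprime (f + g);
  hprimeM : forall f g, hprime g -> hprime (f * g);
  hprime1 : ~ hprime 1;
  hprime_prime : forall f g, hprime (f * g) -> hprime f \/ hprime g;
  hprime_homog : forall f n, hprime f -> hprime (pihomog mdeg n f);
  hprime_irrelevant : ~ (forall i : 'I_2, hprime 'X_i) }.

HB.instance Definition _ := gen_eqMixin projPt.
HB.instance Definition _ := gen_choiceMixin projPt.

(* Zariski topology: the closed sets are V(S) = {P | S included in P}, for S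
   a set of homogeneous polynomials. *)
Definition zariski_open (U : set projPt) : Prop :=
  exists2 S : set A, (forall f, S f -> f \is homog mdeg) &
    U = ~` [set P | S `<=` hprime P].

Lemma zariski_openT : zariski_open setT.
Proof.
exists [set 1] => [f ->|]; first by apply/homogP; exists 0%N; exact: dhomog1.
by apply/esym/seteqP; split=> // P _ /(_ 1 erefl); apply: hprime1.
Qed.

Lemma zariski_openI : setI_closed zariski_open.
Proof.
move=> U V [S hS ->] [T hT ->].
exists [set h | exists f g, [/\ S f, T g & h = f * g]].
  move=> h [f [g [/hS /homogP[m hf] /hT /homogP[n hg] ->]]].
  by apply/homogP; exists (m + n)%N; apply: dhomogM.
apply/seteqP; split=> P /=.
  move=> [nS nT] ST; apply: nS => f Sf; apply: contrapT => nf.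
  apply: nT => g Tg.
  by case: (hprime_prime (ST _ (ex_intro _ f (ex_intro _ g (And3 Sf Tg erefl))))).
move=> nST; split=> h; apply: nST => _ [f [g [Sf Tg ->]]].
  by rewrite mulrC; apply/hprimeM/h.
by apply/hprimeM/h.
Qed.

Lemma zariski_open_bigU (I : Type) (f : I -> set projPt) :
  (forall i, zariski_open (f i)) -> zariski_open (\bigcup_i f i).
Proof.
move=> ofi.
pose S i := s2val (cid2 (ofi i)).
have hS i : forall g, S i g -> g \is homog mdeg := s2valP (cid2 (ofi i)).
have fE i : f i = ~` [set P | S i `<=` hprime P] := s2valP' (cid2 (ofi i)).
exists (\bigcup_i S i) => [g [i _]|]; first exact: hS.
apply/seteqP; split=> P.
  move=> [i _]; rewrite fE => nP SP; apply: nP => g Sg.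
  by apply: SP; exists i.
move=> nP; apply: contrapT => nf; apply: nP => g [i _ Sg].
apply: contrapT => ng; apply: nf; exists i => //; rewrite fE => SP.
exact/ng/SP.
Qed.

HB.instance Definition _ := isOpenTopological.Build projPt
  zariski_openT zariski_openI zariski_open_bigU.

Definition fracB (f : B) (g : A) : grassmann F :=
  Grassmann (tofrac (ev f) / tofrac g) (tofrac (od f) / tofrac g).


Lemma gr_scale_div (E : fieldType) (u v u' v' t t' : E) :
  Grassmann (u / t) (v / t) * Grassmann (u' / t') (v' / t') =
  Grassmann ((u * u') / (t * t')) ((u * v' + v * u') / (t * t')).
Proof. by rewrite grM /= !mulf_div mulrDl. Qed.

Lemma gr_sub_div (E : fieldType) (u v u' v' t t' : E) : t != 0 -> t' != 0 ->
  Grassmann (u / t) (v / t) - Grassmann (u' / t') (v' / t') =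
  Grassmann ((u * t' - u' * t) / (t * t')) ((v * t' - v' * t) / (t * t')).
Proof.
by move=> t0 t'0; rewrite grN grD /= -!mulNr !addf_div // !mulNr.
Qed.

Lemma fracBM f g f' g' : fracB f g * fracB f' g' = fracB (f * f') (g * g').
Proof. by rewrite gr_scale_div /fracB grM /= tofracD !tofracM. Qed.

Lemma fracBB f g f' g' : g != 0 -> g' != 0 ->
  fracB f g - fracB f' g' =
  fracB (f * Grassmann g' 0 - f' * Grassmann g 0) (g * g').
Proof.
move=> g0 g'0; rewrite gr_sub_div ?tofrac_eq0 // /fracB !grM grN grD /=.
by rewrite !mulr0 !add0r !tofracB !tofracM.
Qed.

Lemma in_degB n f g : in_deg n f -> in_deg n g -> in_deg n (f - g).
Proof.
move=> [ef fo] [eg og]; split; first by rewrite grN grD rpredB.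
by case: n fo og {ef eg} => [/= -> ->|n fo og]; rewrite ?subr0 // rpredB.
Qed.

Lemma in_degM m n f g : in_deg m f -> in_deg n g -> in_deg (m + n) (f * g).
Proof.
move=> [ef fo] [eg og]; split; first exact: dhomogM.
case: m n ef fo eg og => [|m] [|n] ef fo eg og; rewrite grM /=.
- by rewrite fo og mul0r mulr0 addr0.
- by rewrite fo mul0r addr0; apply: (dhomogM ef og).
- by rewrite og mulr0 add0r; apply: (dhomogM fo eg).
- by rewrite rpredD //; [rewrite -addSnnS; apply: (dhomogM ef og) |
     apply: (dhomogM fo eg)].
Qed.

Lemma in_deg_even n g : g \is n.-homog -> in_deg n (Grassmann g 0).
Proof. by move=> hg; split=> //=; case: n hg => // n _; apply: rpred0. Qed.

Section Sections.
Variable U : opens projPt.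

(* O(U) in the style of Hartshorne: functions on U that are locally of the form
   f / g with f in B and g in A homogeneous of the same degree.  As A is a
   domain, all the local rings B_(P) embed in F (+) F theta. *)
Definition is_regular (s : set_type U -> grassmann F) : Prop :=
  forall p : set_type U, exists2 V : set projPt, open_nbhs (val p) V &
  exists n f g, [/\ in_deg n f, g \is n.-homog &
    forall q : set_type U, V (val q) -> ~ hprime (val q) g /\ s q = fracB f g].

Definition regular : {pred (set_type U -> grassmann F)} :=
  fun s => `[< is_regular s >].

Lemma regular_subring : subring_closed regular.
Proof.
have nbI p V V' : open_nbhs p V -> open_nbhs p V' -> open_nbhs p (V `&` V').
  by move=> [oV Vp] [oV' V'p]; split; [apply: openI | split].
have ne0 (P : projPt) g : ~ hprime P g -> g != 0.
  by move=> h; apply/eqP => g0; apply: h; rewrite g0; apply: hprime0.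
have gM (P : projPt) g h : ~ hprime P g -> ~ hprime P h -> ~ hprime P (g * h).
  by move=> ng nh /hprime_prime[].
split=> [|s t /asboolP hs /asboolP ht|s t /asboolP hs /asboolP ht];
  apply/asboolP => p.
- exists setT; first by split=> //; apply: openT.
  exists 0%N, 1, 1; split; [exact/in_deg_even/dhomog1 | exact: dhomog1 |].
  move=> q _; split; first exact: hprime1.
  by rewrite /fracB /= tofrac0 tofrac1 divr1 mul0r.
- have [V pV [m [f [g [hf hg sE]]]]] := hs p.
  have [V' pV' [n [f' [g' [hf' hg' tE]]]]] := ht p.
  exists (V `&` V'); first exact: nbI.
  exists (m + n)%N, (f * Grassmann g' 0 - f' * Grassmann g 0), (g * g').
  split; [|exact: dhomogM|].
    apply: in_degB; first exact/in_degM/in_deg_even.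
    by rewrite addnC; apply/in_degM/in_deg_even.
  move=> q [/sE[ng sq] /tE[ng' tq]]; split; first exact: gM.
  by rewrite -fracBB ?(ne0 _ _ ng) ?(ne0 _ _ ng') // -sq -tq.
- have [V pV [m [f [g [hf hg sE]]]]] := hs p.
  have [V' pV' [n [f' [g' [hf' hg' tE]]]]] := ht p.
  exists (V `&` V'); first exact: nbI.
  exists (m + n)%N, (f * f'), (g * g').
  split; [exact: in_degM | exact: dhomogM |].
  move=> q [/sE[ng sq] /tE[ng' tq]]; split; first exact: gM.
  by rewrite -fracBM -sq -tq.
Qed.

HB.instance Definition _ := GRing.isSubringClosed.Build _ regular
  regular_subring.

Record p11_sec := P11Sec { sec_val : set_type U -> grassmann F;
                           _ : sec_val \in regular }.

HB.instance Definition _ := [isSub for sec_val].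
HB.instance Definition _ := [Choice of p11_sec by <:].
HB.instance Definition _ := GRing.SubChoice_isSubComPzRing.Build _ _ p11_sec
  regular_subring.

Lemma p11_secP (s : p11_sec) : is_regular (sec_val s).
Proof. by case: s => s hs; apply/asboolP. Qed.

Lemma p11_sec_inj : injective sec_val.
Proof. exact: val_inj. Qed.

Lemma p11_sec_eq (s t : p11_sec) :
  (forall p, sec_val s p = sec_val t p) -> s = t.
Proof. by move=> h; apply/p11_sec_inj/funext. Qed.

Definition mk_sec (s : set_type U -> grassmann F) (hs : is_regular s) : p11_sec :=
  P11Sec (asboolT hs : s \in regular).

Lemma cst_regular (k : K) :
  is_regular (fun _ => Grassmann (tofrac (mpolyC 2 k)) 0).
Proof.
move=> p; exists setT; first by split=> //; apply: openT.
exists 0%N, (Grassmann (mpolyC 2 k) 0), 1.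
split; [apply: in_deg_even; rewrite -alg_mpolyC; exact/rpredZ/dhomog1 | exact: dhomog1 |].
move=> q _; split; first exact: hprime1.
by rewrite /fracB /= tofrac0 tofrac1 divr1 mul0r.
Qed.

Definition p11_cst (k : K) : p11_sec := mk_sec (cst_regular k).

Lemma part_regular (i : bool) (s : p11_sec) :
  is_regular (fun p => gr_part i (sec_val s p)).
Proof.
move=> p; have [V pV [n [f [g [[ef fo] hg sE]]]]] := p11_secP s p.
exists V => //; exists n, (gr_part i f), g; split=> //.
  case: i; split=> //=; first exact: rpred0.
  by case: n fo {ef hg} => // n _; apply: rpred0.
move=> q /sE[ng ->]; split=> //.
by case: i; rewrite /gr_part /fracB /= tofrac0 mul0r.
Qed.

Definition p11_part i s : p11_sec := mk_sec (part_regular i s).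

Definition p11_grading : grading p11_sec.
Proof.
refine (@Grading _ p11_part _ _ _).
- move=> i s t; apply: p11_sec_eq => p.
  by case: i; apply: gr_eq; rewrite /= ?addr0.
- move=> s; apply: p11_sec_eq => p /=.
  by rewrite [LHS]grD /= addr0 add0r; case: (sec_val s p).
- move=> i j s; apply: p11_sec_eq => p.
  by case: i; case: j.
Defined.

Lemma p11_cst_zmod : zmod_morphism p11_cst.
Proof.
move=> k l; apply: p11_sec_eq => p.
by apply: gr_eq; rewrite /= ?subr0 // mpolyCB tofracB.
Qed.

Lemma p11_cst_monoid : monoid_morphism p11_cst.
Proof.
split=> [|k l]; apply: p11_sec_eq => p; apply: gr_eq => //=.
- by rewrite mpolyCM tofracM.
- by rewrite mulr0 mul0r addr0.
Qed.

HB.instance Definition _ := GRing.isZmodMorphism.Build K p11_sec p11_cst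
  p11_cst_zmod.
HB.instance Definition _ := GRing.isMonoidMorphism.Build K p11_sec p11_cst
  p11_cst_monoid.

Lemma p11_pureE i (s : p11_sec) : pure p11_grading i s <->
  forall p, gr_part i (sec_val s p) = sec_val s p.
Proof.
split=> [h p|h]; first by rewrite -[RHS](congr1 (fun t => sec_val t p) h).
exact: p11_sec_eq.
Qed.

End Sections.

Section Restriction.
Variables (U V : opens projPt) (VU : V `<=` U).

Definition set_incl (p : set_type V) : set_type U :=
  SigSub (mem_set (VU (set_mem (valP p)))).

Lemma res_regular (s : p11_sec U) :
  is_regular (fun p : set_type V => sec_val s (set_incl p)).
Proof.
move=> p; have [W pW [n [f [g [hf hg sE]]]]] := p11_secP s (set_incl p).
by exists W => //; exists n, f, g; split=> // q; apply: (sE (set_incl q)).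
Qed.

Definition p11_res (s : p11_sec U) : p11_sec V := mk_sec (res_regular s).

Lemma p11_res_zmod : zmod_morphism p11_res.
Proof. by move=> s t; apply: p11_sec_eq. Qed.

Lemma p11_res_monoid : monoid_morphism p11_res.
Proof. by split=> [|s t]; apply: p11_sec_eq. Qed.

HB.instance Definition _ := GRing.isZmodMorphism.Build _ _ p11_res p11_res_zmod.
HB.instance Definition _ := GRing.isMonoidMorphism.Build _ _ p11_res
  p11_res_monoid.

End Restriction.

Lemma p11_presheaf :
  is_presheaf (fun (U V : opens projPt) (VU : V `<=` U) => p11_res VU).
Proof.
split=> [U UU s|U V W VU WV WU s]; apply: p11_sec_eq => p /=;
  by congr (sec_val s); apply: val_inj.
Qed.

Lemma p11_sheaf :
  is_sheaf (fun (U V : opens projPt) (VU : V `<=` U) => p11_res VU).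
Proof.
move=> I W U WU cU s sc.
have sE i j (P : projPt) (Pi : P \in oset (W i)) (Pj : P \in oset (W j)) :
    sec_val (s i) (SigSub Pi) = sec_val (s j) (SigSub Pj).
  have Wi : opensI (W i) (W j) `<=` W i by apply: subIsetl.
  have Wj : opensI (W i) (W j) `<=` W j by apply: subIsetr.
  have Pij : P \in oset (opensI (W i) (W j)).
    by apply: mem_set; split; apply: set_mem.
  have := congr1 (fun t => sec_val t (SigSub Pij)) (sc i j _ Wi Wj).
  by rewrite /= => e; etransitivity; [|etransitivity; [exact: e|]];
     congr (sec_val _); apply: val_inj.
have cov (p : set_type U) : exists i, val p \in oset (W i).
  by have [i _ Wp] := cU _ (set_mem (valP p)); exists i; apply: mem_set.
pose t (p : set_type U) :=
  sec_val (s (sval (cid (cov p)))) (SigSub (svalP (cid (cov p)))).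
have tE p i (pi : val p \in oset (W i)) : t p = sec_val (s i) (SigSub pi).
  exact: sE.
have tr : is_regular t.
  move=> p; have [i pi] := cov p.
  have [V [oV Vp] [n [f [g [hf hg h]]]]] := p11_secP (s i) (SigSub pi).
  exists (V `&` W i).
    by split; [apply: openI => //; apply: opensP | split=> //; apply: set_mem].
  exists n, f, g; split=> // q [Vq /mem_set Wq].
  by rewrite (tE _ _ Wq); apply: (h (SigSub Wq)).
exists (mk_sec tr); split=> [i|u uE]; apply: p11_sec_eq => p /=.
  by rewrite (tE (set_incl (WU i) p) i (valP p)); congr (sec_val _); apply: val_inj.
have [i pi] := cov p; rewrite (tE _ _ pi) -uE /=.
by congr (sec_val _); apply: val_inj.
Qed.

Lemma p11_mul (U : opens projPt) i j (a b : p11_sec U) :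
  pure (p11_grading U) i a -> pure (p11_grading U) j b ->
  pure (p11_grading U) (i (+) j) (a * b).
Proof.
move=> /p11_pureE ai /p11_pureE bj; apply/p11_pureE => p.
have -> : sec_val (a * b) p = sec_val a p * sec_val b p by [].
rewrite -ai -bj; apply: gr_eq; case: i j {ai bj} => -[];
  by rewrite /= ?(mulr0, mul0r, addr0, add0r).
Qed.

Lemma p11_comm (U : opens projPt) i j (a b : p11_sec U) :
  pure (p11_grading U) i a -> pure (p11_grading U) j b ->
  a * b = (-1) ^+ (i && j) * (b * a).
Proof.
move=> /p11_pureE ai /p11_pureE bj; rewrite [b * a]mulrC.
case: i ai => ai; last by rewrite mul1r.
case: j bj => bj; last by rewrite mul1r.
suff -> : a * b = 0 by rewrite mulr0.
apply: p11_sec_eq => p.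
have -> : sec_val (a * b) p = sec_val a p * sec_val b p by [].
by rewrite -ai -bj; apply: gr_eq; rewrite /= ?(mulr0, mul0r, addr0).
Qed.

Lemma p11_res_cst (U V : opens projPt) (VU : V `<=` U) k :
  p11_res VU (p11_cst U k) = p11_cst V k.
Proof. exact: p11_sec_eq. Qed.

Lemma p11_res_part (U V : opens projPt) (VU : V `<=` U) i a :
  part (p11_grading V) i (p11_res VU a) = p11_res VU (part (p11_grading U) i a).
Proof. exact: p11_sec_eq. Qed.

Lemma p11_cst_even (U : opens projPt) k :
  pure (p11_grading U) false (p11_cst U k).
Proof. exact/p11_pureE. Qed.

Definition P11 : superSpace K :=
  @SuperSpace K projPt p11_sec (fun U => p11_cst U) p11_grading
    (fun U V VU => p11_res VU) p11_cst_even p11_mul p11_comm p11_res_cst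
    p11_res_part p11_presheaf p11_sheaf.

End P11.

(* Main.v *)
(* Sections of O over a nonempty open set are constant functions, so each is
   determined by its value at the generic point (0).  On the chart x_i <> 0,
   with coordinates z = x_j / x_i and zeta = theta / x_i, D |-> (D z, D zeta)
   identifies T with O (+) Pi O, since a superderivation killing both
   coordinates kills every quotient of homogeneous elements.

   The projection to a summand of a splitting is an even O-linear idempotent e
   of T.  On the chart e (d/dz) = a d/dz + b zeta d/dzeta and
   e (d/dzeta) = c zeta d/dz + d d/dzeta, and e o e = e forces a and d to be 0
   or 1.  Rewriting e (d/dz') in the other chart z' = 1/z, zeta' = zeta/z gives
   the coefficient (a - d) z - z^2 b, which must be regular at z = oo while b is
   a polynomial in z: this is impossible unless a = d, and then b = c = 0.
   Hence e is 0 or the identity on the chart, so T embeds there into one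
   rank-one summand; but zeta kills the odd sections of O and the even sections
   of Pi O, whereas it kills neither d/dz nor d/dzeta. *)

From HB Require Import structures.
Require Import Defs.
From mathcomp Require Import all_boot all_order all_algebra ring.
From mathcomp Require Import mpoly.
From mathcomp Require Import all_classical.
From mathcomp Require Import topology_structure.

Set Implicit Arguments.
Unset Strict Implicit.
Unset Printing Implicit Defensive.

Import GRing.Theory.

Local Open Scope classical_set_scope.
Local Open Scope ring_scope.

(** * Derivations of fraction fields *)

Section FractionDerivation.
Variable R : idomainType.
Implicit Types (a b : R) (x y : {fraction R}).

Lemma fraction_numden x :
  exists p : R * R, p.2 != 0 /\ x = tofrac p.1 / tofrac p.2.
Proof.
elim/quotP: x => r _; exists (frac r); split; first exact: denom_ratioP.
have r2 := denom_ratioP r.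
unlock FracField.tofrac; rewrite -[X in _ = _ * X]FracField.pi_inv -[RHS]FracField.pi_mul.
rewrite /FracField.mulf /FracField.invf /= !numden_Ratio ?oner_neq0 //.
by rewrite mulr1 mul1r Ratio_numden.
Qed.

Variable d : R -> R.
Hypothesis dD : {morph d : a b / a + b}.
Hypothesis dM : forall a b, d (a * b) = d a * b + a * d b.

(** The quotient rule applied to a chosen representative; [frac_der_div] shows that the choice does
    not matter. *)
Definition frac_der x : {fraction R} :=
  let p := sval (cid (fraction_numden x)) in
  tofrac (d p.1 * p.2 - p.1 * d p.2) / tofrac (p.2 ^+ 2).

Lemma frac_der_div a b : b != 0 ->
  frac_der (tofrac a / tofrac b) = tofrac (d a * b - a * d b) / tofrac (b ^+ 2).
Proof.
move=> b0; rewrite /frac_der; case: cid => -[p q] /= [q0 e].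
have {}e : a * q = p * b.
  by apply/eqP; rewrite -tofrac_eq !tofracM -eqr_div ?tofrac_eq0 //; exact/eqP.
have de : d a * q + a * d q = d p * b + p * d b by rewrite -!dM e.
apply/eqP; rewrite eqr_div ?tofrac_eq0 ?expf_neq0 // -!tofracM tofrac_eq.
rewrite -subr_eq0; apply/eqP.
(* The difference of the two cross products is a combination of the relation [e] and of its
   derivative [de]. *)
transitivity (q * b * ((d p * b + p * d b) - (d a * q + a * d q))
  + (a * q - p * b) * (d b * q + d q * b)); first by ring.
by rewrite e de !subrr mulr0 mul0r addr0.
Qed.

Lemma frac_derD : {morph frac_der : x y / x + y}.
Proof.
move=> x y; have [[a b] /= [b0 ->]] := fraction_numden x.
have [[a' b'] /= [b'0 ->]] := fraction_numden y.
rewrite addf_div ?tofrac_eq0 // -!tofracM -tofracD.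
rewrite !frac_der_div ?mulf_neq0 // addf_div ?tofrac_eq0 ?expf_neq0 //.
rewrite -!tofracM -tofracD; apply/eqP.
rewrite eqr_div ?tofrac_eq0 ?mulf_neq0 ?expf_neq0 //.
by rewrite -!tofracM tofrac_eq dD !dM; apply/eqP; ring.
Qed.

Lemma frac_derM x y : frac_der (x * y) = frac_der x * y + x * frac_der y.
Proof.
have [[a b] /= [b0 ->]] := fraction_numden x.
have [[a' b'] /= [b'0 ->]] := fraction_numden y.
rewrite mulf_div -!tofracM !frac_der_div ?mulf_neq0 // !mulf_div.
rewrite addf_div ?mulf_neq0 ?tofrac_eq0 ?expf_neq0 // -!tofracM -tofracD.
apply/eqP; rewrite eqr_div ?tofrac_eq0 ?mulf_neq0 ?expf_neq0 //.
by rewrite -!tofracM tofrac_eq !dM; apply/eqP; ring.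
Qed.

Lemma frac_der_tofrac a : frac_der (tofrac a) = tofrac (d a).
Proof.
have d1 : d 1 = 0.
  by have := dM 1 1; rewrite !mulr1 mul1r -[X in X = _]addr0 => /addrI.
rewrite -[tofrac a]divr1 -tofrac1 frac_der_div ?oner_neq0 //.
by rewrite d1 mulr0 subr0 mulr1 expr1n tofrac1 divr1.
Qed.

End FractionDerivation.

Lemma mulf_split_div (E : fieldType) (c u v w : E) : v != 0 ->
  c * (u * w) = u * v * (c * (w / v)).
Proof. by move=> v0; field. Qed.

(** * Homogeneous polynomials in two variables *)

Section TwoVariables.
Variable K : fieldType.
Notation A := {mpoly K[2]}.
Notation F := {fraction A}.
Implicit Types (f g : A) (i : 'I_2).

(** On two indices [rev_ord] is the exchange, so [rev_ord i] stands throughout for the index j other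
    than i. *)
Lemma rev_ord2 i : (rev_ord i == i) = false.
Proof. by case: i => -[|[]]. Qed.

Lemma ord2P i k : k = i \/ k = rev_ord i.
Proof.
by case: i k => -[|[]] // hi [] [|[]] // hk;
   (left; apply: val_inj; reflexivity) || (right; apply: val_inj; reflexivity).
Qed.

Lemma big_ord2 (T : Type) (idx : T) (op : Monoid.com_law idx) i (E : 'I_2 -> T) :
  \big[op/idx]_k E k = op (E i) (E (rev_ord i)).
Proof.
rewrite (bigD1 i) //= (bigD1 (rev_ord i)) ?rev_ord2 //=.
rewrite big1 ?Monoid.mulm1 // => k; case: (ord2P i k) => ->; rewrite eqxx //.
by rewrite andbF.
Qed.

Lemma X_neq0 i : 'X_i != 0 :> A.
Proof. by rewrite -msize_poly_eq0 msizeX. Qed.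

Lemma dhomogXU i : ('X_i : A) \is 1.-homog.
Proof. by rewrite dhomogX; apply/eqP; apply: mdeg1. Qed.

Lemma dhomog_mderiv i n f : f \is n.+1.-homog -> f^`M(i) \is n.-homog.
Proof.
move=> /dhomogP hf; apply/dhomogP => m; rewrite mcoeff_msupp mcoeff_mderiv => h.
have : f@_(m + U_(i)) != 0 by apply: contraNneq h => ->; rewrite mul0rn.
by rewrite -mcoeff_msupp => /hf /=; rewrite mdegD mdeg1 addn1 => -[].
Qed.

Lemma dhomog0C f : f \is 0.-homog -> exists c, f = c%:MP.
Proof.
move=> hf; exists f@_0; apply/mpolyP => m; rewrite mcoeffC.
have [->|m0] := eqVneq m 0%MM; first by rewrite mulr1.
by rewrite mulr0; apply: (dhomog_nemf_coeff hf); rewrite mdeg_eq0.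
Qed.

(** The variable restores the degree lowered by the derivation; in degree 0 the derivative
    vanishes. *)
Lemma mderivX_mul i k n f : f \is n.-homog -> ('X_k * f^`M(i)) \is n.-homog.
Proof.
case: n => [/dhomog0C[c ->]|n hf]; first by rewrite mderivC mulr0 dhomog0.
by apply: (dhomogM (d := 1%N)); [apply: dhomogXU | apply: dhomog_mderiv].
Qed.

(** A monomial of degree n with exponent b in x_j equals x_i^n z^b, where z = x_j / x_i; hence f =
    x_i^n f(1, z). *)
Lemma tofrac_dehomog i n f : f \is n.-homog ->
  tofrac f = tofrac 'X_i ^+ n * \sum_(m <- msupp f)
    tofrac (f@_m)%:MP * (tofrac 'X_(rev_ord i) / tofrac 'X_i) ^+ m (rev_ord i).
Proof.
move=> /dhomogP hf; rewrite {1}[f]mpolyE rmorph_sum mulr_sumr !big_seq.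
apply: eq_bigr => m /hf /=.
rewrite mdegE (big_ord2 _ i) /= => <-.
rewrite mpolyXE_id (big_ord2 _ i) /= -mul_mpolyC !tofracM !tofracXn.
have X0 : tofrac ('X_i : A) != 0 by rewrite tofrac_eq0 X_neq0.
rewrite exprD expr_div_n.
rewrite (mulf_split_div _ _ _ (expf_neq0 (m (rev_ord i)) X0)) //.
Qed.

End TwoVariables.

(** * Points and generic values *)

Section Points.
Variable K : fieldType.
Notation A := {mpoly K[2]}.
Implicit Types (f g : A) (u : 'I_2 -> K).

(* Restriction of f to the line through u: f (u_0 X, u_1 X). *)
Definition line_eval u : A -> {poly K} := mmap (@polyC K) (fun i => u i *: 'X).

HB.instance Definition _ u := GRing.RMorphism.copy (line_eval u)
  (mmap (@polyC K) (fun i => u i *: 'X)).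

Lemma line_evalX u (m : 'X_{1..2}) :
  line_eval u 'X_[m] = ('X_[m]).@[u] *: 'X^(mdeg m).
Proof.
rewrite /line_eval mmapX mevalX mdegE /mmap1 !(big_ord2 _ ord0) /=.
by rewrite !exprZn -scalerAl -scalerAr scalerA -exprD.
Qed.

(** On the line through u a monomial of degree n becomes a multiple of X^n, so the coefficients
    separate the homogeneous components. The kernel of [line_eval u] is therefore a homogeneous
    ideal. *)
Lemma coef_line_eval u f n : (line_eval u f)`_n = (pihomog mdeg n f).@[u].
Proof.
rewrite {1}[f]mpolyE rmorph_sum coef_sum pihomogE rmorph_sum [RHS]big_mkcond /=.
apply: eq_bigr => m _.
rewrite -mul_mpolyC rmorphM /= {1}/line_eval mmapC line_evalX coefCM coefZ coefXn.
rewrite mul_mpolyC mevalZ eq_sym; case: ifP => _; by rewrite ?mulr1 ?mulr0.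
Qed.

Lemma line_eval_homog u f n : f \is n.-homog ->
  line_eval u f = f.@[u] *: 'X^n.
Proof.
move=> hf; apply/polyP => k; rewrite coef_line_eval coefZ coefXn.
have [->|kn] := eqVneq k n; first by rewrite pihomog_dE // mulr1.
by rewrite (pihomog_ne0 _ hf) 1?eq_sym // meval0 mulr0.
Qed.

Section ClosedPoint.
Variables (u : 'I_2 -> K) (u0 : exists i, u i != 0).

(** The homogeneous ideal of the point [u_0 : u_1], obtained as the kernel of the restriction to the
    line: it is prime because [{poly K}] is a domain. *)
Definition closedPt : projPt K.
Proof.
refine (@ProjPt K [set f | line_eval u f = 0] _ _ _ _ _ _ _) => /=.
- exact: rmorph0.
- by move=> f g f0 g0; rewrite rmorphD /= f0 g0 addr0.
- by move=> f g g0; rewrite rmorphM /= g0 mulr0.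
- by rewrite rmorph1; apply/eqP/oner_neq0.
- by move=> f g; rewrite rmorphM => /eqP; rewrite mulf_eq0 => /orP[]/eqP; [left|right].
- move=> f n f0; rewrite (line_eval_homog _ (pihomogP _ _ _)) -coef_line_eval.
  by rewrite f0 coef0 scale0r.
- move=> h; have [i] := u0; have := h i.
  rewrite /line_eval mmapX mmap1U => /(congr1 (fun p : {poly K} => p`_1)).
  by rewrite coefZ coefX mulr1 coef0 => ->; rewrite eqxx.
Defined.

Lemma closedPtE f n : f \is n.-homog -> hprime closedPt f <-> f.@[u] = 0.
Proof.
move=> hf; rewrite /= (line_eval_homog _ hf); split=> [|->]; last by rewrite scale0r.
by move/(congr1 (fun p : {poly K} => p`_n)); rewrite coefZ coefXn eqxx mulr1 coef0.
Qed.

End ClosedPoint.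

Definition genPt : projPt K.
Proof.
refine (@ProjPt K [set 0] _ _ _ _ _ _ _) => /=.
- by [].
- by move=> f g -> ->; rewrite addr0.
- by move=> f g ->; rewrite mulr0.
- exact/eqP/oner_neq0.
- by move=> f g /eqP; rewrite mulf_eq0 => /orP[]/eqP; [left|right].
- by move=> f n ->; rewrite pihomog0.
- by move=> /(_ ord0)/eqP; rewrite (negPf (X_neq0 _ _)).
Defined.

Definition nonvanish f (hf : f \is homog mdeg) : set (projPt K) :=
  [set P | ~ hprime P f].

Lemma open_nonvanish f (hf : f \is homog mdeg) : open (nonvanish hf).
Proof.
exists [set f] => [_ ->//|].
by apply/seteqP; split=> P /= h; [move/(_ f erefl) | move=> Pf; apply: h => _ ->].
Qed.

(** The generators S of the complement are not all in P, hence not all zero. *)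
Lemma genPt_open (U : set (projPt K)) P : open U -> U P -> U genPt.
Proof.
case=> S _ -> nP gS; apply: nP => f /gS /= ->; exact: hprime0.
Qed.

End Points.

(** * Sections and their values at the generic point *)

Section GenericValue.
Variable K : fieldType.
Notation A := {mpoly K[2]}.
Notation F := {fraction A}.
Notation X := (P11 K).
Implicit Types (U V W : opens X) (x y : grassmann F).

(** Membership in the degree 0 part of the localization of B at P, seen inside F (+) F theta. *)
Definition reg_at (P : projPt K) x : Prop := exists n f g,
  [/\ in_deg n f, g \is n.-homog, ~ hprime P g & x = fracB f g].

(* The value at the generic point; the junk value 0 is taken on the empty set. *)
Definition gval U (a : sec U) : grassmann F :=
  match pselect (oset U (genPt K)) with
  | left h => sec_val a (SigSub (mem_set h))
  | right _ => 0
  end.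

(** A single fraction f / g represents the section near p, and this neighbourhood contains the
    generic point. *)
Lemma sec_val_gval U (a : sec U) p : sec_val a p = gval a.
Proof.
have [V [oV Vp] [n [f [g [_ _ aE]]]]] := p11_secP a p.
rewrite /gval; case: pselect => h; last first.
  by case: h; apply: (@genPt_open _ _ (val p)); [apply: opensP | apply: set_mem (valP p)].
by rewrite (aE p Vp).2 (aE (SigSub (mem_set h)) (genPt_open oV Vp)).2.
Qed.

(** The condition on the generic point excludes only the empty set, over which any two sections
    agree. *)
Lemma gval_inj U (a b : sec U) :
  (oset U (genPt K) -> gval a = gval b) -> a = b.
Proof.
move=> h; apply: p11_sec_eq => p; rewrite !sec_val_gval; apply: h.
by apply: (@genPt_open _ _ (val p)); [apply: opensP | apply: set_mem (valP p)].
Qed.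

Lemma gvalD U (a b : sec U) : gval (a + b) = gval a + gval b.
Proof. by rewrite /gval; case: pselect => // _; rewrite addr0. Qed.

Lemma gvalN U (a : sec U) : gval (- a) = - gval a.
Proof. by rewrite /gval; case: pselect => // _; rewrite oppr0. Qed.

Lemma gvalM U (a b : sec U) : gval (a * b) = gval a * gval b.
Proof. by rewrite /gval; case: pselect => // _; rewrite mulr0. Qed.

Lemma gval0 U : gval (0 : sec U) = 0.
Proof. by rewrite /gval; case: pselect. Qed.

Lemma gval1 U : oset U (genPt K) -> gval (1 : sec U) = 1.
Proof. by rewrite /gval; case: pselect. Qed.

Lemma gval_scst U k : oset U (genPt K) ->
  gval (scst U k) = Grassmann (tofrac (mpolyC 2 k)) 0.
Proof. by rewrite /gval; case: pselect. Qed.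

Lemma gval_part U i (a : sec U) : gval (part (sgr U) i a) = gr_part i (gval a).
Proof. by rewrite /gval; case: pselect => // _; case: i. Qed.

Lemma gval_res U V (VU : V `<=` U) (a : sec U) : oset V (genPt K) ->
  gval (res VU a) = gval a.
Proof.
move=> h; rewrite /gval; case: pselect => // h1; case: pselect => [h2|[]]; last exact: VU.
by congr (sec_val a _); apply: val_inj.
Qed.

Lemma gval_pure U i (a : sec U) : pure (sgr U) i a <-> gr_part i (gval a) = gval a.
Proof.
split=> [<-|h]; last by apply: gval_inj => _; rewrite gval_part.
by rewrite gval_part; case: i.
Qed.

Lemma gval_reg_at U (a : sec U) P : oset U P -> reg_at P (gval a).
Proof.
move=> UP; have [V [oV Vp] [n [f [g [hf hg aE]]]]] := p11_secP a (SigSub (mem_set UP)).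
have [ng aP] := aE (SigSub (mem_set UP)) Vp.
by exists n, f, g; split=> //; rewrite -aP sec_val_gval.
Qed.

Section ConstantSection.
Variables (U : opens X) (x : grassmann F).
Hypothesis xU : forall P, oset U P -> reg_at P x.

(** A fraction representing x at p still represents it wherever its denominator does not vanish,
    which is an open condition. This is the converse of [gval_reg_at]. *)
Lemma const_regular : is_regular (fun _ : set_type (oset U) => x).
Proof.
move=> p; have [n [f [g [hf hg ng xE]]]] := xU (set_mem (valP p)).
have hh : g \is homog mdeg by apply/homogP; exists n.
exists (nonvanish hh); first by split=> //; apply: open_nonvanish.
by exists n, f, g.
Qed.

Definition const_sec : sec U := mk_sec const_regular.

Lemma gval_const_sec : oset U (genPt K) -> gval const_sec = x.
Proof. by rewrite /gval; case: pselect. Qed.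

End ConstantSection.

End GenericValue.

(** * The coordinate vector fields *)

Section HomogeneousOperators.
Variables (K : fieldType) (X : superSpace K) (U : opens X).

Section Parity.
Variables (i : bool) (D : sec_op U).
Hypothesis linD : is_lin_op D.
Hypothesis parD : forall (V : opens X) (VU : V `<=` U) j a,
  pure (sgr V) j a -> pure (sgr V) (i (+) j) (D VU a).

Lemma homogeneous_op_part k : op_part k D = if k == i then D else @op_zero K X U.
Proof.
apply: op_eq => V VU a; rewrite /op_part.
rewrite !(part_pure _ (parD VU (pure_part (sgr V) _ a))) addbF addbT.
case: eqP => [->|/eqP ki]; first by rewrite eqxx -lin_opD // part_sum.
have -> : (~~ k == ~~ i) = false by rewrite (inj_eq negb_inj); apply: negPf.
by rewrite addr0.
Qed.

(** The component of the other parity is zero, so a single Leibniz rule has content. *)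
Lemma homogeneous_superder : is_nat_op D -> is_leibniz i D -> is_superder D.
Proof.
move=> nD LD; split=> // k; rewrite homogeneous_op_part.
case: eqP => [->|_] //= V VU j a b _.
by rewrite /op_zero mul0r !mulr0 addr0.
Qed.

End Parity.

(** For even a no sign appears in the Leibniz rule of either component, and the two rules add up
    even if [D] is not homogeneous. *)
Lemma superder_mul_even (D : superder U) (V : opens X) (VU : V `<=` U) a b :
  pure (sgr V) false a ->
  der_op D VU (a * b) = der_op D VU a * b + a * der_op D VU b.
Proof.
move=> a0; have [nD lD LD] := superderP D.
rewrite -(op_part_sum lD) /op_add !(LD _ _ _ _ _ _ a0) !andbF !mul1r.
have H x y z w : x * b + a * z + (y * b + a * w) = (x + y) * b + a * (z + w).
  by rewrite mulrDl mulrDr addrACA.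
exact: H.
Qed.

Lemma superder_scst (D : superder U) (V : opens X) (VU : V `<=` U) k :
  der_op D VU (scst V k) = 0.
Proof.
have [nD lD LD] := superderP D.
have D1 : der_op D VU 1 = 0.
  have e1 : pure (sgr V) false 1 by rewrite -(rmorph1 (scst V)); apply: scst_even.
  have := superder_mul_even D VU 1 e1.
  by rewrite !mulr1 mul1r -[X in X = _]addr0 => /addrI.
by rewrite -[scst V k]mulr1 -[X in der_op _ _ X]addr0 lD lin_op0 // D1 mulr0 addr0.
Qed.

End HomogeneousOperators.

(** * Superderivations induced by operators on F (+) F theta *)

Section LiftedOperators.
Variable K : fieldType.
Notation A := {mpoly K[2]}.
Notation F := {fraction A}.
Notation X := (P11 K).
Implicit Types (U V W : opens X) (x y : grassmann F).

Section Lift.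
Variables (i : bool) (phi : grassmann F -> grassmann F).
Hypothesis phi_reg : forall P x, reg_at P x -> reg_at P (phi x).

(** Sections being constant, an operator on generic values that preserves regularity at every point
    acts on the sections over every open set. *)
Definition lift_op U : sec_op U := fun V VU a =>
  const_sec (fun P VP => phi_reg (gval_reg_at a VP)).

Lemma gval_lift_op U V (VU : V `<=` U) a :
  oset V (genPt K) -> gval (lift_op VU a) = phi (gval a).
Proof. exact: gval_const_sec. Qed.

Hypothesis phi_lin : forall k x y,
  phi (Grassmann (tofrac (mpolyC 2 k)) 0 * x + y) =
  Grassmann (tofrac (mpolyC 2 k)) 0 * phi x + phi y.
Hypothesis phi_parity : forall j x,
  gr_part j x = x -> gr_part (i (+) j) (phi x) = phi x.
Hypothesis phi_leibniz : forall j x y, gr_part j x = x ->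
  phi (x * y) = phi x * y + (-1) ^+ (i && j) * (x * phi y).

Lemma lift_op_nat U : is_nat_op (@lift_op U).
Proof.
move=> V W VU WU WV a; apply: gval_inj => Wg.
by rewrite gval_lift_op // !gval_res // gval_lift_op //; apply: WV.
Qed.

Lemma lift_op_lin U : is_lin_op (@lift_op U).
Proof.
move=> V VU k a b; apply: gval_inj => Vg.
by rewrite gvalD gvalM !gval_lift_op // gvalD gvalM gval_scst // phi_lin.
Qed.

Lemma lift_op_parity U V (VU : V `<=` U) j a :
  pure (sgr V) j a -> pure (sgr V) (i (+) j) (lift_op VU a).
Proof.
move=> /gval_pure aj.
have [Vg|nVg] := pselect (oset V (genPt K)); last by apply: gval_inj.
by apply/gval_pure; rewrite gval_lift_op // phi_parity.
Qed.

Lemma lift_op_leibniz U : is_leibniz i (@lift_op U).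
Proof.
move=> V VU j a b /gval_pure aj; apply: gval_inj => Vg.
rewrite gvalD !gvalM !gval_lift_op // gvalM (phi_leibniz _ aj); congr (_ + _ * _).
case: (i && j) => /=; last by rewrite gval1.
by rewrite !expr1 gvalN gval1.
Qed.

Definition lift_der U : superder U := Superder
  (homogeneous_superder (@lift_op_lin U) (@lift_op_parity U) (@lift_op_nat U)
     (@lift_op_leibniz U)).

Lemma lift_der_pure U : pure (der_grading U) i (lift_der U).
Proof.
apply: superder_inj.
by rewrite /= (homogeneous_op_part (@lift_op_lin U) (@lift_op_parity U)) eqxx.
Qed.

End Lift.

Section CoordinateFields.
Variable i : 'I_2.
Notation xi := (tofrac ('X_i : A)).
Notation dF := (frac_der (@mderiv 2 K (rev_ord i))).

Lemma derFD : {morph dF : x y / x + y}.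
Proof. by apply: frac_derD; [apply: mderivD | apply: mderivM]. Qed.

Lemma derFM (x y : F) : dF (x * y) = dF x * y + x * dF y.
Proof. by apply: frac_derM; apply: mderivM. Qed.

Lemma derFC k : dF (tofrac (mpolyC 2 k)) = 0.
Proof. by rewrite frac_der_tofrac ?mderivC ?tofrac0 //; apply: mderivM. Qed.

Lemma derF0 : dF 0 = 0.
Proof. by rewrite -tofrac0 -(mpolyC0 2) derFC. Qed.

Lemma derF1 : dF 1 = 0.
Proof. by rewrite -tofrac1 -(mpolyC1 2) derFC. Qed.

(* With od x theta = (od x x_i) zeta, these are d/dzeta and d/dz. *)
Definition zeta_phi x : grassmann F := Grassmann (od x * xi) 0.
Definition z_phi x : grassmann F := Grassmann (xi * dF (ev x)) (xi * dF (od x)).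

Lemma zeta_phi_reg P x : reg_at P x -> reg_at P (zeta_phi x).
Proof.
move=> [n [f [g [[_ fo] hg ng ->]]]].
exists n, (Grassmann (od f * 'X_i) 0), g; split=> //.
  apply: in_deg_even; case: n fo {hg} => [->|n fo]; first by rewrite mul0r dhomog0.
  by rewrite -[n.+1]addn1; apply: dhomogM fo (dhomogXU _ _).
by apply: gr_eq; rewrite /= ?tofrac0 ?mul0r // tofracM mulrAC.
Qed.

(** The quotient rule gives the denominator g^2 and lowers the degree of the numerator by one, which
    the factor x_i makes up for. *)
Lemma z_phi_reg P x : reg_at P x -> reg_at P (z_phi x).
Proof.
move=> [n [f [g [[fe fo] hg ng ->]]]].
have g0 : g != 0 by apply/eqP => g0; apply: ng; rewrite g0; apply: hprime0.
pose h f := 'X_i * (f^`M(rev_ord i) * g - f * g^`M(rev_ord i)).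
have hh k e : e \is k.-homog -> h e \is (k + n).-homog.
  move=> he; rewrite /h mulrBr mulrA mulrCA; apply: rpredB.
    by apply: dhomogM hg; apply: mderivX_mul.
  by apply: dhomogM he _; apply: mderivX_mul.
exists (n + n)%N, (Grassmann (h (ev f)) (h (od f))), (g ^+ 2); split.
- split; first exact: hh.
  case: n fo hh {fe hg} => [|m] fo hh /=; last exact: hh.
  by rewrite fo /h mderiv0 !mul0r subr0 mulr0.
- by rewrite expr2; apply: dhomogM.
- by rewrite expr2 => /hprime_prime[].
apply: gr_eq; rewrite /= frac_der_div ?tofracM ?mulrA //; apply: mderivM.
Qed.

Lemma zeta_phi_lin k x y :
  zeta_phi (Grassmann (tofrac (mpolyC 2 k)) 0 * x + y) =
  Grassmann (tofrac (mpolyC 2 k)) 0 * zeta_phi x + zeta_phi y.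
Proof.
by apply: gr_eq; rewrite /= ?(mul0r, mulr0, addr0) // mulrDl mulrA.
Qed.

Lemma z_phi_lin k x y :
  z_phi (Grassmann (tofrac (mpolyC 2 k)) 0 * x + y) =
  Grassmann (tofrac (mpolyC 2 k)) 0 * z_phi x + z_phi y.
Proof.
by apply: gr_eq; rewrite /= ?mul0r ?addr0 derFD derFM derFC mul0r add0r mulrDr mulrCA.
Qed.

Lemma zeta_phi_parity j x :
  gr_part j x = x -> gr_part (true (+) j) (zeta_phi x) = zeta_phi x.
Proof. by case: j => /= <-; apply: gr_eq; rewrite /= ?mul0r. Qed.

Lemma z_phi_parity j x :
  gr_part j x = x -> gr_part (false (+) j) (z_phi x) = z_phi x.
Proof. by case: j => /= <-; apply: gr_eq; rewrite /= ?derF0 ?mulr0. Qed.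

Lemma zeta_phi_leibniz j x y : gr_part j x = x ->
  zeta_phi (x * y) = zeta_phi x * y + (-1) ^+ (true && j) * (x * zeta_phi y).
Proof.
case: j => /= <-; rewrite ?expr1 ?expr0 ?mulN1r ?mul1r; apply: gr_eq;
  rewrite /= ?(mul0r, mulr0, addr0, add0r, oppr0) //.
- by rewrite mulrAC.
- by rewrite mulrA mulrAC subrr.
- by rewrite mulrA.
Qed.

Lemma z_phi_leibniz j x y : gr_part j x = x ->
  z_phi (x * y) = z_phi x * y + (-1) ^+ (false && j) * (x * z_phi y).
Proof.
move=> _; rewrite /= expr0 mul1r; apply: gr_eq; rewrite /= ?derFD !derFM !mulrDr.
  by rewrite !mulrA [ev x * xi]mulrC.
rewrite !mulrA ![_ x * xi]mulrC -!addrA; congr (_ + _).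
by rewrite addrCA addrC -addrA; congr (_ + _); rewrite addrC.
Qed.

Definition der_zeta U : superder U :=
  lift_der zeta_phi_reg zeta_phi_lin zeta_phi_parity zeta_phi_leibniz U.
Definition der_z U : superder U :=
  lift_der z_phi_reg z_phi_lin z_phi_parity z_phi_leibniz U.

Lemma der_zeta_pure U : pure (der_grading U) true (der_zeta U).
Proof. exact: lift_der_pure. Qed.

Lemma der_z_pure U : pure (der_grading U) false (der_z U).
Proof. exact: lift_der_pure. Qed.

End CoordinateFields.

End LiftedOperators.

(** * The tangent bundle on the standard charts *)

Lemma divf_cancel (E : fieldType) (a g x : E) : g != 0 ->
  g / x * (a / g) = a / x.
Proof. by move=> g0; rewrite mulrC mulrA divfK. Qed.

Section SuperderEvaluation.
Variables (K : fieldType) (X : superSpace K) (U V : opens X) (VU : V `<=` U).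
Implicit Types (D E : superder U).

Lemma der_opD D E a : der_op (D + E) VU a = der_op D VU a + der_op E VU a.
Proof. by []. Qed.

Lemma der_opN D a : der_op (- D) VU a = - der_op D VU a.
Proof. by []. Qed.

Lemma der_opZ c D a : der_op (c *: D) VU a = res VU c * der_op D VU a.
Proof. by []. Qed.

Lemma der_op_part i D j a : pure (sgr V) j a ->
  der_op (part (der_grading U) i D) VU a = part (sgr V) (i (+) j) (der_op D VU a).
Proof. by move=> aj; apply: op_part_pure => //; have [] := superderP D. Qed.

End SuperderEvaluation.

Section Charts.
Variable K : fieldType.
Notation A := {mpoly K[2]}.
Notation F := {fraction A}.
Notation X := (P11 K).
Implicit Types (U V W : opens X) (x y : F).

Lemma homogXU (i : 'I_2) : ('X_i : A) \is homog mdeg.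
Proof. by apply/homogP; exists 1%N; apply: dhomogXU. Qed.

Definition chart (i : 'I_2) : opens X := Opens (open_nonvanish (homogXU i)).

Lemma chart_cover (P : X) : exists i, oset (chart i) P.
Proof.
apply: contrapT => h; apply: (@hprime_irrelevant _ P) => i.
by apply: contrapT => hi; apply: h; exists i.
Qed.

Lemma genPt_chart i : oset (chart i) (genPt K).
Proof. by move/eqP; rewrite (negPf (X_neq0 _ _)). Qed.

Definition fz (i : 'I_2) : F := tofrac 'X_(rev_ord i) / tofrac 'X_i.
(** The coefficient of theta in the odd coordinate zeta = theta / x_i. *)
Definition fzeta (i : 'I_2) : F := (tofrac 'X_i)^-1.

Lemma tofracX_neq0 (i : 'I_2) : tofrac ('X_i : A) != 0.
Proof. by rewrite tofrac_eq0 X_neq0. Qed.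

Section Coordinates.
Variable i : 'I_2.

Lemma fz_reg P : oset (chart i) P -> reg_at P (Grassmann (fz i) 0).
Proof.
move=> Pi; exists 1%N, (Grassmann 'X_(rev_ord i) 0), 'X_i; split=> //.
- by apply: in_deg_even; apply: dhomogXU.
- exact: dhomogXU.
- by rewrite /fracB /= tofrac0 mul0r.
Qed.

Lemma fzeta_reg P : oset (chart i) P -> reg_at P (Grassmann 0 (fzeta i)).
Proof.
move=> Pi; exists 1%N, (Grassmann 0 1), 'X_i; split=> //.
- by split; [apply: rpred0 | apply: dhomog1].
- exact: dhomogXU.
- by rewrite /fracB /= tofrac0 mul0r tofrac1 mul1r.
Qed.

Definition coord_z V (Vi : V `<=` chart i) : sec V :=
  const_sec (fun P VP => fz_reg (Vi P VP)).
Definition coord_zeta V (Vi : V `<=` chart i) : sec V :=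
  const_sec (fun P VP => fzeta_reg (Vi P VP)).

Lemma gval_coord_z V (Vi : V `<=` chart i) :
  oset V (genPt K) -> gval (coord_z Vi) = Grassmann (fz i) 0.
Proof. exact: gval_const_sec. Qed.

Lemma gval_coord_zeta V (Vi : V `<=` chart i) :
  oset V (genPt K) -> gval (coord_zeta Vi) = Grassmann 0 (fzeta i).
Proof. exact: gval_const_sec. Qed.

Lemma coord_z_even V (Vi : V `<=` chart i) : pure (sgr V) false (coord_z Vi).
Proof.
by apply: gval_inj => Vg; rewrite gval_part gval_coord_z.
Qed.

Lemma coord_zeta_odd V (Vi : V `<=` chart i) : pure (sgr V) true (coord_zeta Vi).
Proof.
by apply: gval_inj => Vg; rewrite gval_part gval_coord_zeta.
Qed.

Lemma res_coord_z U V (VU : V `<=` U) (Ui : U `<=` chart i) (Vi : V `<=` chart i) :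
  res VU (coord_z Ui) = coord_z Vi.
Proof. by apply: gval_inj => Vg; rewrite gval_res // !gval_coord_z //; apply: VU. Qed.

Lemma res_coord_zeta U V (VU : V `<=` U) (Ui : U `<=` chart i) (Vi : V `<=` chart i) :
  res VU (coord_zeta Ui) = coord_zeta Vi.
Proof. by apply: gval_inj => Vg; rewrite gval_res // !gval_coord_zeta //; apply: VU. Qed.

Section KilledFunctions.
Variables (U W : opens X) (WU : W `<=` U) (D : superder U).
Hypothesis Wg : oset W (genPt K).

(** These functions contain the constants and are closed under sums and products, so a
    superderivation that kills z kills every polynomial in z. *)
Definition killed (x : F) : Prop :=
  exists2 s : sec W, gval s = Grassmann x 0 & der_op D WU s = 0.

Lemma killedC k : killed (tofrac (mpolyC 2 k)).
Proof. by exists (scst W k); [rewrite gval_scst | apply: superder_scst]. Qed.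

Lemma killedD x y : killed x -> killed y -> killed (x + y).
Proof.
move=> [s sx Ds] [t ty Dt]; exists (s + t).
  by rewrite gvalD sx ty grD /= addr0.
by have [_ lD _] := superderP D; rewrite lin_opD // Ds Dt addr0.
Qed.

Lemma killedM x y : killed x -> killed y -> killed (x * y).
Proof.
move=> [s sx Ds] [t ty Dt]; exists (s * t).
  by rewrite gvalM sx ty grM /= mulr0 mul0r addr0.
rewrite superder_mul_even ?Ds ?Dt ?mulr0 ?mul0r ?addr0 //.
by apply/gval_pure; rewrite sx.
Qed.

(** By [tofrac_dehomog] the quotient is a polynomial in z with constant coefficients. *)
Lemma killed_homog f n : killed (fz i) -> f \is n.-homog ->
  killed (tofrac f / tofrac 'X_i ^+ n).
Proof.
move=> kz hf; rewrite (tofrac_dehomog i hf) mulrAC divff ?expf_neq0 ?tofracX_neq0 //.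
rewrite mul1r; apply: (big_ind killed).
- by rewrite -tofrac0 -(mpolyC0 2); apply: killedC.
- exact: killedD.
move=> m _; apply: killedM; first exact: killedC.
elim: (m _) => [|k IH]; first by rewrite expr0 -tofrac1 -(mpolyC1 2); apply: killedC.
by rewrite exprS; apply: killedM.
Qed.

End KilledFunctions.

(** A section a = f / g satisfies G a = P + Q, where G, P and Q are g, the even part and the odd
    part of f, each divided by x_i^n. All three are killed by [D], so G D a = 0, and G is a nonzero
    element of F. *)
Lemma der_eq0 V (Vi : V `<=` chart i) (VV : V `<=` V) (D : superder V) :
  der_op D VV (coord_z Vi) = 0 -> der_op D VV (coord_zeta Vi) = 0 -> D = 0.
Proof.
move=> Dz Dzeta; apply: superder_inj; apply: op_eq => W WV a.
apply: gval_inj => Wg; rewrite [RHS](gval0 W).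
have [nD lD LD] := superderP D.
have Wi : W `<=` chart i by move=> P /WV/Vi.
have kz : killed WV D (fz i).
  exists (coord_z Wi); first exact: gval_coord_z.
  by rewrite -(res_coord_z WV Vi) (nD _ _ VV) Dz rmorph0.
have DzetaW : der_op D WV (coord_zeta Wi) = 0.
  by rewrite -(res_coord_zeta WV Vi) (nD _ _ VV) Dzeta rmorph0.
have [n [f [g [[fe fo] hg ng aE]]]] := gval_reg_at a Wg.
have g0 : tofrac g != 0 by rewrite tofrac_eq0; apply/eqP => g0; apply: ng.
have xn0 k : tofrac ('X_i : A) ^+ k != 0 by rewrite expf_neq0 ?tofracX_neq0.
have [G GE DG] := killed_homog Wg kz hg.
have [P PE DP] := killed_homog Wg kz fe.
(* The odd coefficient has degree n - 1, and zeta supplies the missing factor 1 / x_i; for n = 0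
   this coefficient is zero. *)
have [Q QE DQ] : exists2 Q : sec W,
    gval Q = Grassmann 0 (tofrac (od f) / tofrac 'X_i ^+ n) & der_op D WV Q = 0.
  case: n fo {hg fe aE GE PE} => [->|n fo].
    exists 0; first by rewrite gval0 tofrac0 mul0r.
    by rewrite lin_op0.
  have [Q QE DQ] := killed_homog Wg kz fo.
  exists (Q * coord_zeta Wi).
    rewrite gvalM QE gval_coord_zeta // grM /= !mul0r mulr0 addr0.
    by rewrite exprSr invfM /fzeta mulrA.
  rewrite superder_mul_even ?DQ ?DzetaW ?mulr0 ?mul0r ?addr0 //.
  by apply/gval_pure; rewrite QE.
have e : G * a = P + Q.
  apply: gval_inj => _; rewrite gvalM gvalD GE PE QE aE; apply: gr_eq => /=.
    by rewrite addr0; apply: divf_cancel.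
  by rewrite add0r mul0r addr0; apply: divf_cancel.
have := congr1 (der_op D WV) e.
rewrite lin_opD // DP DQ superder_mul_even ?DG ?mul0r ?add0r ?addr0; last first.
  by apply/gval_pure; rewrite GE.
move=> /(congr1 (@gval _ _)); rewrite gvalM gval0 GE grM /= mul0r addr0.
have gn0 := mulf_neq0 g0 (invr_neq0 (xn0 n)).
case=> /eqP; rewrite mulf_eq0 (negPf gn0) /= => /eqP e0 /eqP.
by rewrite mulf_eq0 (negPf gn0) /= => /eqP e1; apply: gr_eq.
Qed.

Section Frame.
Variables (V : opens X) (Vi : V `<=` chart i) (VV : V `<=` V).

Lemma dF_X k : frac_der (@mderiv 2 K (rev_ord i)) (tofrac 'X_k) =
  (k == rev_ord i)%:R.
Proof.
rewrite frac_der_tofrac; last exact: mderivM.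
rewrite mderivX mnm1E; case: eqP => [->|_]; last by rewrite scale0r tofrac0.
have -> : (U_(rev_ord i) - U_(rev_ord i) = 0 :> 'X_{1..2})%MM.
  by apply/mnmP => l; rewrite mnmBE mnm0E subnn.
by rewrite mpolyX0 scale1r tofrac1.
Qed.

Lemma der_z_z : der_op (der_z i V) VV (coord_z Vi) = 1.
Proof.
apply: gval_inj => Vg; rewrite gval_lift_op // gval_coord_z // gval1 //.
rewrite /z_phi /= derF0 mulr0; congr Grassmann.
(* The derivative of z is read off from the product rule for z x_i = x_j. *)
have := derFM i (fz i) (tofrac 'X_i).
rewrite divfK ?tofracX_neq0 // !dF_X eqxx eq_sym rev_ord2 mulr0 addr0 => e.
by rewrite mulrC -e.
Qed.

Lemma der_z_zeta : der_op (der_z i V) VV (coord_zeta Vi) = 0.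
Proof.
apply: gval_inj => Vg; rewrite gval_lift_op // gval_coord_zeta // gval0.
rewrite /z_phi /= derF0 mulr0; congr Grassmann.
have := derFM i (fzeta i) (tofrac 'X_i).
rewrite mulVf ?tofracX_neq0 // dF_X eq_sym rev_ord2 mulr0 addr0 derF1.
by rewrite mulrC => <-.
Qed.

Lemma der_zeta_z : der_op (der_zeta i V) VV (coord_z Vi) = 0.
Proof.
apply: gval_inj => Vg; rewrite gval_lift_op // gval_coord_z // gval0.
by rewrite /zeta_phi /= mul0r.
Qed.

Lemma der_zeta_zeta : der_op (der_zeta i V) VV (coord_zeta Vi) = 1.
Proof.
apply: gval_inj => Vg; rewrite gval_lift_op // gval_coord_zeta // gval1 //.
by rewrite /zeta_phi /= mulVf ?tofracX_neq0.
Qed.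

(** Both sides take the same values on z and zeta, so [der_eq0] applies to their difference. *)
Lemma der_frame (D : superder V) :
  D = der_op D VV (coord_z Vi) *: der_z i V
    + der_op D VV (coord_zeta Vi) *: der_zeta i V.
Proof.
apply/eqP; rewrite -subr_eq0; apply/eqP.
apply: (der_eq0 (Vi := Vi) (VV := VV));
  rewrite der_opD der_opN der_opD !der_opZ !res_id.
  by rewrite der_z_z der_zeta_z mulr1 mulr0 addr0 subrr.
by rewrite der_z_zeta der_zeta_zeta mulr1 mulr0 add0r subrr.
Qed.

End Frame.

End Coordinates.

End Charts.

(** * Local triviality of the tangent sheaf, with rank 1|1 *)

Section TangentBundle.
Variable K : fieldType.
Notation X := (P11 K).

Section ChartFrame.
Variables (i : 'I_2) (V : opens X) (Vi : V `<=` chart K i).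
Notation frame_sec := (msec (free_mod X 1 1) V).

Definition frame_coord (D : superder V) : frame_sec := fun k =>
  match k with
  | inl _ => der_op D (@subset_refl _ V) (coord_z Vi)
  | inr _ => der_op D (@subset_refl _ V) (coord_zeta Vi)
  end.

Definition frame_comb (s : frame_sec) : superder V :=
  (s (inl ord0) : sec V) *: der_z i V + (s (inr ord0) : sec V) *: der_zeta i V.

Lemma frame_coordK : cancel frame_coord frame_comb.
Proof. by move=> D; rewrite /frame_comb -der_frame. Qed.

Lemma frame_combK : cancel frame_comb frame_coord.
Proof.
move=> s; pose VV := @subset_refl _ V.
have ez : der_op (frame_comb s) VV (coord_z Vi) = s (inl ord0).
  by rewrite der_opD !der_opZ !res_id der_z_z der_zeta_z mulr1 mulr0 addr0.
have ezeta : der_op (frame_comb s) VV (coord_zeta Vi) = s (inr ord0).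
  by rewrite der_opD !der_opZ !res_id der_z_zeta der_zeta_zeta mulr1 mulr0 add0r.
by apply: functional_extensionality_dep => -[k|k]; rewrite (ord1 k).
Qed.

End ChartFrame.

Lemma tangent_bundle : is_bundle 1 1 (tangent X).
Proof.
move=> P; have [i Pi] := chart_cover P; exists (chart K i) => //.
exists (fun V Vi => @frame_coord i V Vi); split.
- move=> V Vi a D E; pose VV := @subset_refl _ V.
  have H c : der_op (a *: D + E) VV c = a * der_op D VV c + der_op E VV c.
    by rewrite der_opD der_opZ res_id.
  by apply: functional_extensionality_dep => -[l|l]; apply: H.
- move=> V Vi k D; pose VV := @subset_refl _ V.
  have ez := der_op_part VV k D (coord_z_even Vi).
  have ezeta := der_op_part VV k D (coord_zeta_odd Vi).
  (* Evaluation at the odd coordinate zeta reverses parity, which is why the second summand is Pi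
     O. *)
  rewrite addbF in ez; rewrite addbT in ezeta.
  by apply: functional_extensionality_dep => -[l|l]; [apply: ez | apply: ezeta].
- move=> U V Ui Vi VU D; have [nD _ _] := superderP D.
  pose UU := @subset_refl _ U; pose VV := @subset_refl _ V.
  have H a : der_op (der_res VU D) VV (res VU a) = res VU (der_op D UU a).
    by rewrite -(nD _ _ UU VU); exact: (der_op_irr D (subset_trans VV VU) VU).
  have ez := H (coord_z Ui); have ezeta := H (coord_zeta Ui).
  rewrite (res_coord_z VU Ui Vi) in ez; rewrite (res_coord_zeta VU Ui Vi) in ezeta.
  by apply: functional_extensionality_dep => -[l|l]; [apply: ez | apply: ezeta].
- move=> V Vi; exists (@frame_comb i V); [exact: frame_coordK | exact: frame_combK].
Qed.

End TangentBundle.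

(** * Sections regular on a chart are polynomials *)

(** A rational function regular at every point of the affine line is a polynomial: once p / q is
    reduced, a nonconstant denominator would have a root, and no presentation exists there. *)
Lemma dvdp_local (K : closedFieldType) (p q : {poly K}) : q != 0 ->
  (forall t, exists f g : {poly K}, g.[t] != 0 /\ p * g = f * q) -> (q %| p)%R.
Proof.
move=> q0 H; pose h := gcdp p q.
have hp : p %/ h * h = p by rewrite divpK // dvdp_gcdl.
have hq : q %/ h * h = q by rewrite divpK // dvdp_gcdr.
have h0 : h != 0 by rewrite gcdp_eq0 negb_and q0 orbT.
have co : coprimep (q %/ h) (p %/ h).
  by rewrite coprimep_sym; apply: coprimep_div_gcd; rewrite q0 orbT.
have [s1|/closed_rootP[t qt]] := eqVneq (size (q %/ h)) 1%N.
  rewrite -hq -hp dvdp_mul2r //; apply: (@dvdp_trans _ 1); last exact: dvd1p.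
  by rewrite dvdp1 s1.
have [f [g [gt e]]] := H t; case/negP: (coprimep_root co qt).
have /(congr1 (fun r : {poly K} => r.[t])) : p %/ h * g = f * (q %/ h).
  by apply: (mulIf h0); rewrite mulrAC hp -mulrA hq.
rewrite !hornerM (rootP qt) mulr0 => /eqP.
by rewrite mulf_eq0 (negPf gt) orbF.
Qed.

(** * Dehomogenization and the closed points of the projective line *)

Section Dehomogenization.
Variables (K : fieldType) (i : 'I_2).
Notation A := {mpoly K[2]}.
Implicit Types f g : A.

Definition dehom : A -> {poly K} :=
  mmap (@polyC K) (fun k => if k == i then 1 else 'X).

HB.instance Definition _ := GRing.RMorphism.copy dehom
  (mmap (@polyC K) (fun k => if k == i then 1 else 'X)).

Lemma dehomX m : dehom 'X_[m] = 'X^(m (rev_ord i)).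
Proof.
by rewrite /dehom mmapX /mmap1 (big_ord2 _ i) /= eqxx rev_ord2 expr1n mul1r.
Qed.

Lemma dehomXi : dehom 'X_i = 1.
Proof. by rewrite /dehom mmapX mmap1U eqxx. Qed.

Lemma dehomXj : dehom 'X_(rev_ord i) = 'X.
Proof. by rewrite /dehom mmapX mmap1U rev_ord2. Qed.

Lemma dehomC k : dehom (mpolyC 2 k) = k%:P.
Proof. by rewrite /dehom mmapC. Qed.

Lemma dehomE f : dehom f = \sum_(m <- msupp f) f@_m *: 'X^(m (rev_ord i)).
Proof.
rewrite {1}[f]mpolyE rmorph_sum; apply: eq_bigr => m _ /=.
by rewrite -mul_mpolyC rmorphM /= dehomC dehomX mul_polyC.
Qed.

Definition affinePt (t : K) : 'I_2 -> K := fun k => if k == i then 1 else t.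
(** The point z = oo, where x_i vanishes. *)
Definition infPt : 'I_2 -> K := fun k => if k == i then 0 else 1.

Lemma horner_dehom f t : (dehom f).[t] = f.@[affinePt t].
Proof.
rewrite dehomE horner_sum mevalE; apply: eq_bigr => m _.
rewrite hornerZ hornerXn (big_ord2 _ i) /= /affinePt eqxx rev_ord2.
by rewrite expr1n mul1r.
Qed.

Lemma size_dehom f n : f \is n.-homog -> (size (dehom f) <= n.+1)%N.
Proof.
move=> /dhomogP hf; rewrite dehomE big_seq.
apply: (big_ind (fun p : {poly K} => (size p <= n.+1)%N)).
- by rewrite size_poly0.
- by move=> p q sp sq; apply: leq_trans (size_polyD _ _) _; rewrite geq_max sp.
move=> m /hf /=; rewrite mdegE (big_ord2 _ i) /= => <-.
apply: leq_trans (size_scale_leq _ _) _.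
by rewrite size_polyXn ltnS leq_addl.
Qed.

(** Only the monomial x_j^n contributes to either side. Thus f does not vanish at z = oo exactly
    when f(1, z) has full degree n. *)
Lemma coef_dehom f n : f \is n.-homog -> (dehom f)`_n = f.@[infPt].
Proof.
move=> /dhomogP hf; rewrite dehomE coef_sum mevalE !big_seq.
apply: eq_bigr => m /hf /=; rewrite mdegE (big_ord2 _ i) /= => <-.
rewrite coefZ coefXn (big_ord2 _ i) /= /infPt eqxx rev_ord2 expr1n mulr1 expr0n.
by rewrite -{2}[m (rev_ord i)]add0n eqn_add2r.
Qed.

Lemma affinePt_neq0 t : exists k, affinePt t k != 0.
Proof. by exists i; rewrite /affinePt eqxx oner_neq0. Qed.

Lemma infPt_neq0 : exists k, infPt k != 0.
Proof. by exists (rev_ord i); rewrite /infPt rev_ord2 oner_neq0. Qed.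

Lemma affinePt_chart t : oset (chart K i) (closedPt (affinePt_neq0 t)).
Proof.
move/(closedPtE (affinePt_neq0 t) (dhomogXU _ i)).1 => /eqP.
by rewrite mevalXU /affinePt eqxx oner_eq0.
Qed.

Lemma infPt_chart : oset (chart K (rev_ord i)) (closedPt infPt_neq0).
Proof.
move/(closedPtE infPt_neq0 (dhomogXU _ (rev_ord i))).1 => /eqP.
by rewrite mevalXU /infPt rev_ord2 oner_eq0.
Qed.

End Dehomogenization.

(** Over an arbitrary field, [field] clears the denominators; [frac_transition] brings the result
    back to the ring. *)
Lemma field_transition (E : fieldType) (f g x y c f0 g0 : E) :
  g != 0 -> x != 0 -> g0 != 0 ->
  f / g = c * x^-1 - y / x * (f0 / g0) -> f * (x * g0) = g * (c * g0 - y * f0).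
Proof.
move=> g1 x1 g01 e; have -> : f = f / g * g by rewrite divfK.
by rewrite e; field; apply/andP.
Qed.

Section CrossMultiplication.
Variable R : idomainType.
Implicit Types f g x y : R.

Lemma frac_cross f0 g0 f g : g0 != 0 -> g != 0 ->
  tofrac f0 / tofrac g0 = tofrac f / tofrac g -> f0 * g = f * g0.
Proof.
move=> g00 g1 /eqP; rewrite eqr_div ?tofrac_eq0 // -!tofracM tofrac_eq.
by move/eqP.
Qed.

Lemma frac_transition f g x y c f0 g0 : g != 0 -> x != 0 -> g0 != 0 ->
  tofrac f / tofrac g =
    tofrac c * (tofrac x)^-1 - tofrac y / tofrac x * (tofrac f0 / tofrac g0) ->
  f * (x * g0) = g * (c * g0 - y * f0).
Proof.
move=> g1 x1 g01 e; apply/eqP; rewrite -tofrac_eq !(tofracM, tofracB).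
by apply/eqP; apply: field_transition e; rewrite tofrac_eq0.
Qed.

End CrossMultiplication.

(** * Impossibility of the transition c z - z^2 beta *)

Section NoTransition.
Variables (K : closedFieldType) (i : 'I_2).
Notation A := {mpoly K[2]}.
Notation F := {fraction A}.

Lemma odd_reg_frac P (b : F) : reg_at P (Grassmann 0 b) ->
  exists n (f g : A), [/\ f = 0 \/ (exists2 m, n = m.+1 & f \is m.-homog),
    g \is n.-homog, ~ hprime P g & b = tofrac f / tofrac g].
Proof.
move=> [n [f [g [[_ fo] hg ng [_ ->]]]]]; exists n, (od f), g; split=> //.
by case: n fo {hg} => [|m] fo; [left | right; exists m].
Qed.

(* Writing b = beta / x_i and b' = beta' / x_j, the excluded identity is
   beta' = c z - z^2 beta with z = x_j / x_i. *)
Lemma no_transition (c : K) (b b' : F) : c != 0 ->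
  (forall P, oset (chart K i) P -> reg_at P (Grassmann 0 b)) ->
  (forall P, oset (chart K (rev_ord i)) P -> reg_at P (Grassmann 0 b')) ->
  b' <> tofrac (mpolyC 2 c) * fzeta K i - fz K i * b.
Proof.
move=> c0 rb rb' e.
have nz P (g : A) : ~ hprime P g -> g != 0.
  by move=> ng; apply/eqP => g0; apply: ng; rewrite g0; apply: hprime0.
(* The presentation at z = 0 serves as the reference one for [b]. *)
have [n0 [f0 [g0 [_ hg0 ng0 b0]]]] := odd_reg_frac (rb _ (@affinePt_chart K i 0)).
have dg0 : dehom i g0 != 0.
  apply: contra_notN ng0 => /eqP d0; apply/(closedPtE _ hg0).
  by rewrite -horner_dehom d0 horner0.
(* Regularity at every affine point z = t makes f0 / g0 a polynomial P in z once x_i = 1. *)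
have /dvdpP [P dP] : dehom i g0 %| dehom i f0.
  apply: dvdp_local => // t.
  have [n [f [g [_ hg ng bE]]]] := odd_reg_frac (rb _ (@affinePt_chart K i t)).
  exists (dehom i f), (dehom i g); split.
    rewrite horner_dehom; apply/eqP => g1; apply: ng; exact/(closedPtE _ hg).
  rewrite -!rmorphM /=; congr (dehom i _); apply: frac_cross.
  - exact: nz ng0.
  - exact: nz ng.
  - by rewrite -b0.
have [n [f [g [hf hg ng b'E]]]] := odd_reg_frac (rb' _ (@infPt_chart K i)).
have dgn : (dehom i g)`_n != 0.
  by rewrite coef_dehom //; apply/eqP => g1; apply: ng; apply/(closedPtE _ hg).
have : f * ('X_i * g0) = g * (mpolyC 2 c * g0 - 'X_(rev_ord i) * f0).
  apply: frac_transition; [exact: nz ng | exact: X_neq0 | exact: nz ng0 |].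
  by rewrite -b'E -b0.
move=> /(congr1 (dehom i)).
rewrite !(rmorphM, rmorphB) /= dehomXi mul1r dehomXj dehomC dP mulrA -mulrBl mulrA.
move=> /(mulIf dg0) fE.
(* The constant term is c, which is nonzero. *)
have cP0 : c%:P - 'X * P != 0.
  apply: contraNneq c0 => /(congr1 (fun p : {poly K} => p`_0)).
  by rewrite coefB coefC coefXM coef0 subr0 /= => ->.
have g1 : dehom i g != 0 by apply: contraNneq dgn => ->; rewrite coef0.
have sg : (n < size (dehom i g))%N.
  by rewrite ltnNge; apply: contra dgn => /(nth_default 0) ->.
(* Degrees now conflict in [fE]: g(1, z) has degree at least n by regularity at z = oo, whereas f
   has degree n - 1 or is zero, theta having degree 1. *)
have : (size (dehom i f) <= n)%N.
  case: hf => [->|[m -> hf]]; first by rewrite rmorph0 size_poly0.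
  exact: size_dehom.
have s0 : (0 < size (c%:P - 'X * P)%R)%N by rewrite lt0n size_poly_eq0.
apply/negP; rewrite -ltnNge fE size_mul // -(prednK s0) addnS /=.
exact: leq_trans sg (leq_addr _ _).
Qed.

End NoTransition.

(** * Idempotent endomorphisms of the tangent bundle *)

Section CoordinateChange.
Variable K : fieldType.
Notation A := {mpoly K[2]}.
Notation F := {fraction A}.
Notation X := (P11 K).
Variable i : 'I_2.
Notation j := (rev_ord i).

Definition overlap : opens X := opensI (chart K i) (chart K j).

Lemma overlap_l : overlap `<=` chart K i. Proof. exact: subIsetl. Qed.
Lemma overlap_r : overlap `<=` chart K j. Proof. exact: subIsetr. Qed.

Lemma genPt_overlap : oset overlap (genPt K).
Proof. by split; apply: genPt_chart. Qed.

Variables (WW : overlap `<=` overlap) (Wi : overlap `<=` chart K i)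
  (Wj : overlap `<=` chart K j).
Notation z := (coord_z Wi).
Notation zeta := (coord_zeta Wi).
Notation z' := (coord_z Wj).
Notation zeta' := (coord_zeta Wj).

Lemma fz_inv : fz K i * fz K j = 1.
Proof.
by rewrite /fz rev_ordK mulrC mulrA divfK ?divff ?tofracX_neq0.
Qed.

Lemma fzeta_change : fzeta K j = fz K j * fzeta K i.
Proof. by rewrite /fz /fzeta rev_ordK mulrAC divff ?mul1r ?tofracX_neq0. Qed.

(** Differentiating z z' = 1 gives D z' = - z'^2 D z, which is substituted in the Leibniz rule for
    zeta' = z' zeta. *)
Lemma der_coord_change (D : superder overlap) :
  gval (der_op D WW zeta') =
  Grassmann (fz K j) 0 * gval (der_op D WW zeta)
  - gval (der_op D WW z) * Grassmann 0 (fz K j ^+ 2 * fzeta K i).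
Proof.
have Wg := genPt_overlap.
have D1 : der_op D WW 1 = 0 by rewrite -(rmorph1 (scst overlap)); apply: superder_scst.
have e1 : z * z' = 1.
  apply: gval_inj => _; rewrite gvalM !gval_coord_z // gval1 //.
  by apply: gr_eq; rewrite /= ?fz_inv ?mulr0 ?mul0r ?addr0.
have e2 : zeta' = z' * zeta.
  apply: gval_inj => _; rewrite gvalM !gval_coord_zeta // gval_coord_z //.
  by apply: gr_eq; rewrite /= ?mulr0 ?mul0r ?addr0 // fzeta_change.
have := congr1 (@gval _ _) (congr1 (der_op D WW) e1).
rewrite D1 superder_mul_even; last exact: coord_z_even.
rewrite gvalD !gvalM gval0 !gval_coord_z // => e3.
rewrite e2 superder_mul_even; last exact: coord_z_even.
rewrite gvalD !gvalM gval_coord_z // gval_coord_zeta // addrC; congr (_ + _).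
have e4 : gval (der_op D WW z') = - (gval (der_op D WW z) * Grassmann (fz K j ^+ 2) 0).
  apply/eqP; rewrite -addr_eq0; apply/eqP.
  have -> : Grassmann (fz K j ^+ 2) 0 = Grassmann (fz K j) 0 * Grassmann (fz K j) 0.
    by apply: gr_eq; rewrite /= ?expr2 ?mulr0 ?mul0r ?addr0.
  have e5 : Grassmann (fz K j) 0 * Grassmann (fz K i) 0 = 1.
    by apply: gr_eq; rewrite /= ?mulr0 ?mul0r ?addr0 // mulrC fz_inv.
  rewrite mulrA -{1}[gval (der_op D WW z')]mul1r -e5.
  by rewrite [X in _ + X]mulrC -mulrA -mulrDr addrC e3 mulr0.
by rewrite e4 mulNr -mulrA; congr (- (_ * _)); apply: gr_eq; rewrite /= ?mul0r ?mulr0 ?addr0.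
Qed.

(** Together with [der_z_change_zeta] this reads d/dz' = - z^2 d/dz - z zeta d/dzeta. *)
Lemma der_z_change_z : gval (der_op (der_z j overlap) WW z) =
  Grassmann (- fz K i ^+ 2) 0.
Proof.
rewrite gval_lift_op ?gval_coord_z; try exact: genPt_overlap.
rewrite /z_phi /= derF0 mulr0; congr Grassmann.
have := derFM j (fz K i) (tofrac 'X_i).
rewrite divfK ?tofracX_neq0 // !dF_X rev_ordK rev_ord2 eqxx mulr1 => /esym/eqP.
rewrite addr_eq0 => /eqP e; apply: (mulIf (tofracX_neq0 K i)).
by rewrite -mulrA e mulrN !mulNr expr2 -mulrA divfK ?tofracX_neq0 // mulrC.
Qed.

Lemma der_z_change_zeta : gval (der_op (der_z j overlap) WW zeta) =
  Grassmann 0 (- (fz K i * fzeta K i)).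
Proof.
rewrite gval_lift_op ?gval_coord_zeta; try exact: genPt_overlap.
rewrite /z_phi /= derF0 mulr0; congr Grassmann.
have := derFM j (fzeta K i) (tofrac 'X_i).
rewrite mulVf ?tofracX_neq0 // derF1 dF_X rev_ordK eqxx mulr1 => /esym/eqP.
rewrite addr_eq0 => /eqP e; apply: (mulIf (tofracX_neq0 K i)).
rewrite -mulrA e mulrN mulNr; congr (- _).
by rewrite /fz mulrAC divfK ?tofracX_neq0.
Qed.

Lemma res_der_z k (U V : opens X) (VU : V `<=` U) :
  der_res VU (der_z k U) = der_z k V.
Proof. exact: superder_inj. Qed.

Lemma res_der_zeta k (U V : opens X) (VU : V `<=` U) :
  der_res VU (der_zeta k U) = der_zeta k V.
Proof. exact: superder_inj. Qed.

End CoordinateChange.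

Lemma idem01 (E : fieldType) (a : E) : a = a * a -> a = 0 \/ a = 1.
Proof.
move=> e; have /eqP : a * (1 - a) = 0 by rewrite mulrBr mulr1 -e subrr.
rewrite mulf_eq0 subr_eq0 => /orP[/eqP|/eqP]; [by left | by right].
Qed.

(** With x = z, y = z' and t = 1 / x_i, the brackets are the values on zeta' of e (d/dz) and e
    (d/dzeta), given by [der_coord_change]; the entry c disappears because theta^2 = 0. *)
Lemma grassmann_transition (E : fieldType) (x y t a b c d : E) : x * y = 1 ->
  od (Grassmann (- x ^+ 2) 0 *
        (Grassmann y 0 * Grassmann 0 b - Grassmann a 0 * Grassmann 0 (y ^+ 2 * t))
      + Grassmann 0 (- (x * t)) *
        (Grassmann y 0 * Grassmann d 0 - Grassmann 0 c * Grassmann 0 (y ^+ 2 * t)))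
  = (a - d) * t - x * b.
Proof.
move=> xy; rewrite /=.
transitivity ((x * y) ^+ 2 * (a * t) - (x * y) * (t * d) - x * (x * y) * b).
  by ring.
by rewrite xy; ring.
Qed.

Lemma der_pure_op (K : fieldType) (X : superSpace K) (U V : opens X)
    (VU : V `<=` U) k j (D : superder U) (a : sec V) :
  pure (der_grading U) k D -> pure (sgr V) j a ->
  pure (sgr V) (k (+) j) (der_op D VU a).
Proof.
by move=> Dk aj; rewrite -{1}Dk (der_op_part _ _ _ aj); apply: pure_part.
Qed.

Section IdempotentEndomorphism.
Variable K : closedFieldType.
Notation A := {mpoly K[2]}.
Notation F := {fraction A}.
Notation X := (P11 K).
Implicit Types U V : opens X.

Variable e : forall U, superder U -> superder U.
Hypothesis eZD : forall U (a : sec U) (D E : superder U), e (a *: D + E) = a *: e D + e E.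
Hypothesis e_part : forall U k (D : superder U),
  e (part (der_grading U) k D) = part (der_grading U) k (e D).
Hypothesis e_res : forall U V (VU : V `<=` U) (D : superder U),
  e (der_res VU D) = der_res VU (e D).
Hypothesis e_idem : forall U (D : superder U), e (e D) = e D.

Lemma endo0 U : e (0 : superder U) = 0.
Proof.
have := eZD (1 : sec U) 0 0.
by rewrite !scale1r addr0 -[X in X = _]addr0 => /addrI.
Qed.

Lemma endo_pure U k (D : superder U) :
  pure (der_grading U) k D -> pure (der_grading U) k (e D).
Proof. by rewrite /pure -e_part => ->. Qed.

Lemma endo_frame U (a b : sec U) (D E : superder U) :
  e (a *: D + b *: E) = a *: e D + b *: e E.
Proof. by rewrite eZD -[b *: E]addr0 eZD endo0 addr0. Qed.

Variable i : 'I_2.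
Notation j := (rev_ord i).
Notation U := (chart K i).
Let UU : U `<=` U := @subset_refl _ U.
Notation z := (coord_z UU).
Notation zeta := (coord_zeta UU).
Notation Ez := (e (der_z i U)).
Notation Ezeta := (e (der_zeta i U)).

Let Ug : oset U (genPt K) := @genPt_chart K i.

(** As [e] preserves parity, these four entries describe it on the frame. Here [b] and [c] are
    coefficients of theta, that is, those of zeta divided by x_i. *)
Let a := ev (gval (der_op Ez UU z)).
Let b := od (gval (der_op Ez UU zeta)).
Let c := od (gval (der_op Ezeta UU z)).
Let d := ev (gval (der_op Ezeta UU zeta)).

Let Ez_z : gval (der_op Ez UU z) = Grassmann a 0.
Proof.
have /gval_pure <- // : pure (sgr U) false (der_op Ez UU z).
apply: (@der_pure_op _ _ _ _ _ false false); last exact: coord_z_even.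
exact/endo_pure/der_z_pure.
Qed.

Let Ez_zeta : gval (der_op Ez UU zeta) = Grassmann 0 b.
Proof.
have /gval_pure <- // : pure (sgr U) true (der_op Ez UU zeta).
apply: (@der_pure_op _ _ _ _ _ false true); last exact: coord_zeta_odd.
exact/endo_pure/der_z_pure.
Qed.

Let Ezeta_z : gval (der_op Ezeta UU z) = Grassmann 0 c.
Proof.
have /gval_pure <- // : pure (sgr U) true (der_op Ezeta UU z).
apply: (@der_pure_op _ _ _ _ _ true false); last exact: coord_z_even.
exact/endo_pure/der_zeta_pure.
Qed.

Let Ezeta_zeta : gval (der_op Ezeta UU zeta) = Grassmann d 0.
Proof.
have /gval_pure <- // : pure (sgr U) false (der_op Ezeta UU zeta).
apply: (@der_pure_op _ _ _ _ _ true true); last exact: coord_zeta_odd.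
exact/endo_pure/der_zeta_pure.
Qed.

Let e_frame (D : superder U) :
  e D = der_op D UU z *: Ez + der_op D UU zeta *: Ezeta.
Proof. by rewrite {1}(der_frame UU UU D) endo_frame. Qed.

Let e_frame_op (D : superder U) x : gval (der_op (e (e D)) UU x) =
  gval (der_op (e D) UU z) * gval (der_op Ez UU x)
  + gval (der_op (e D) UU zeta) * gval (der_op Ezeta UU x).
Proof. by rewrite {1}e_frame der_opD !der_opZ !res_id gvalD !gvalM. Qed.

(** The entries of the matrix identity e^2 = e; the products of [b] and [c] vanish since theta^2 =
    0. *)
Let idem_eqs : [/\ a = a * a, b = a * b + b * d, c = c * a + d * c & d = d * d].
Proof.
have h1 := e_frame_op (der_z i U) z; have h2 := e_frame_op (der_z i U) zeta.
have h3 := e_frame_op (der_zeta i U) z; have h4 := e_frame_op (der_zeta i U) zeta.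
rewrite e_idem Ez_z Ez_zeta Ezeta_z in h1; rewrite e_idem Ez_z Ez_zeta Ezeta_zeta in h2.
rewrite e_idem Ezeta_z Ezeta_zeta Ez_z in h3; rewrite e_idem Ezeta_z Ezeta_zeta Ez_zeta in h4.
split.
- by have := congr1 (@ev _) h1; rewrite /= mul0r addr0.
- by have := congr1 (@od _) h2; rewrite /= !mul0r addr0 add0r.
- by have := congr1 (@od _) h3; rewrite /= !mul0r add0r addr0 addrC.
- by have := congr1 (@ev _) h4; rewrite /= mul0r add0r.
Qed.

(** The theta coefficient b' of e (d/dz') zeta' is regular on the second chart. Since [e] commutes
    with restriction, it can be recomputed on the overlap in the frame of the first chart. *)
Let transition : exists b', (forall P, oset (chart K j) P -> reg_at P (Grassmann 0 b')) /\
  b' = (a - d) * fzeta K i - fz K i * b.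
Proof.
pose UjUj : chart K j `<=` chart K j := @subset_refl _ _.
pose s := der_op (e (der_z j (chart K j))) UjUj (coord_zeta UjUj).
have sE : gval s = Grassmann 0 (od (gval s)).
  have /gval_pure <- // : pure (sgr (chart K j)) true s.
  apply: (@der_pure_op _ _ _ _ _ false true); last exact: coord_zeta_odd.
  exact/endo_pure/der_z_pure.
exists (od (gval s)); split=> [P Pj|]; first by rewrite -sE; apply: gval_reg_at.
have Wg := @genPt_overlap K i.
pose W := overlap K i; pose WW : W `<=` W := @subset_refl _ W.
have WUj := overlap_r (K := K) (i := i); have WU := overlap_l (K := K) (i := i).
have resE V (VU : W `<=` V) (V1 : V `<=` V) (D : superder V) (x : sec V) :
    gval (der_op (der_res VU D) WW (res VU x)) = gval (der_op D V1 x).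
  have [nD _ _] := superderP D.
  rewrite -[RHS](gval_res VU) // -(nD _ _ _ VU).
  by congr gval; exact: (der_op_irr D (subset_trans WW VU) VU).
have : gval s = gval (der_op (e (der_z j W)) WW (coord_zeta WUj)).
  by rewrite -(res_der_z j WUj) e_res -(res_coord_zeta WUj UjUj) resE.
rewrite {1}(der_frame WU WW (der_z j W)) endo_frame der_opD !der_opZ !res_id.
rewrite -(res_der_z i WU) -(res_der_zeta i WU) !e_res gvalD !gvalM.
rewrite !der_coord_change der_z_change_z der_z_change_zeta.
rewrite -!(res_coord_z WU UU) -!(res_coord_zeta WU UU) !resE.
rewrite Ez_z Ez_zeta Ezeta_z Ezeta_zeta => /(congr1 (@od _)) ->.
exact/grassmann_transition/fz_inv.
Qed.

Let no_transition_c (k : K) : k != 0 -> a - d <> tofrac (mpolyC 2 k).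
Proof.
move=> k0 adk; have [b' [rb' b'E]] := transition.
apply: (no_transition k0 _ rb'); last by rewrite b'E adk.
by move=> P UP; rewrite -Ez_zeta; apply: gval_reg_at.
Qed.

Let frame_dichotomy : Ez = 0 /\ Ezeta = 0 \/ Ez = der_z i U /\ Ezeta = der_zeta i U.
Proof.
have [ha hb hc hd] := idem_eqs.
(* Otherwise a - d is 1 or -1, a nonzero constant. *)
have ad : a = d.
  have [a0|a1] := idem01 ha; have [d0|d1] := idem01 hd; rewrite ?a0 ?a1 ?d0 ?d1 //.
    case: (@no_transition_c (-1)); first by rewrite oppr_eq0 oner_neq0.
    by rewrite a0 d1 sub0r mpolyCN mpolyC1 tofracN tofrac1.
  case: (@no_transition_c 1); first exact: oner_neq0.
  by rewrite a1 d0 subr0 mpolyC1 tofrac1.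
(* With a = d the equation becomes b = 2 a b, which gives b = 0 for a = 0 and for a = 1 alike; c is
   treated in the same way. *)
have b0 : b = 0.
  have [a0|a1] := idem01 ha; first by rewrite hb -ad a0 mul0r mulr0 addr0.
  by move: hb; rewrite -ad a1 mul1r mulr1 -[X in X = _]addr0 => /addrI.
have c0 : c = 0.
  have [a0|a1] := idem01 ha; first by rewrite hc -ad a0 mul0r mulr0 addr0.
  by move: hc; rewrite -ad a1 mul1r mulr1 -[X in X = _]addr0 => /addrI.
have Ez_zeta0 : der_op Ez UU zeta = 0 by apply: gval_inj => _; rewrite Ez_zeta b0 gval0.
have Ezeta_z0 : der_op Ezeta UU z = 0 by apply: gval_inj => _; rewrite Ezeta_z c0 gval0.
have [a0|a1] := idem01 ha; [left | right].
  split; apply: (der_eq0 (Vi := UU) (VV := UU)) => //; apply: gval_inj => _; rewrite gval0.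
    by rewrite Ez_z a0.
  by rewrite Ezeta_zeta -ad a0.
split.
  have Ez_z1 : der_op Ez UU z = 1 by apply: gval_inj => _; rewrite Ez_z a1 gval1.
  by rewrite {1}(der_frame UU UU Ez) Ez_z1 Ez_zeta0 scale1r scale0r addr0.
have Ezeta_zeta1 : der_op Ezeta UU zeta = 1.
  by apply: gval_inj => _; rewrite Ezeta_zeta -ad a1 gval1.
by rewrite {1}(der_frame UU UU Ezeta) Ezeta_zeta1 Ezeta_z0 scale1r scale0r add0r.
Qed.

(** The frame of the chart restricts to a frame on each smaller open set, so linearity and
    naturality carry the dichotomy over. *)
Lemma idempotent_endo_trivial :
  (forall V (VU : V `<=` U) (D : superder V), e D = 0) \/
  (forall V (VU : V `<=` U) (D : superder V), e D = D).
Proof.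
have E V (VU : V `<=` U) (VV : V `<=` V) (D : superder V) :
    e D = der_op D VV (coord_z VU) *: der_res VU Ez
      + der_op D VV (coord_zeta VU) *: der_res VU Ezeta.
  rewrite {1}(der_frame VU VV D) endo_frame.
  by rewrite -(res_der_z i VU) -(res_der_zeta i VU) !e_res.
case: frame_dichotomy => -[Ez0 Ezeta0]; [left | right] => V VU D.
  rewrite (E V VU (@subset_refl _ V)) Ez0 Ezeta0.
  have -> : der_res VU (0 : superder U) = 0 by apply: superder_inj.
  by rewrite !scaler0 addr0.
rewrite (E V VU (@subset_refl _ V)) Ez0 Ezeta0 res_der_z res_der_zeta.
by rewrite -der_frame.
Qed.

End IdempotentEndomorphism.

(** * Splittings *)

Lemma iso0 (K : fieldType) (X : superSpace K) (W : opens X) (F G : superMod X)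
    (f : forall V : opens X, V `<=` W -> msec F V -> msec G V) :
  (forall (V : opens X) (VW : V `<=` W) a m n,
     f V VW (a *: m + n) = a *: f V VW m + f V VW n) ->
  forall (V : opens X) (VW : V `<=` W), f V VW 0 = 0.
Proof.
move=> lin V VW; have := lin V VW 1 0 0.
by rewrite !scale1r addr0 -[X in X = _]addr0 => /addrI.
Qed.

Section SummandProjection.
Variables (K : fieldType) (X : superSpace K) (I : finType).
Variables (F : superMod X) (L : I -> superMod X).
Variable f : forall V : opens X, V `<=` opensT X -> msec F V -> msec (dsum L) V.
Hypothesis f_lin : forall (V : opens X) (VT : V `<=` opensT X) a m n,
  f VT (a *: m + n) = a *: f VT m + f VT n.
Hypothesis f_part : forall (V : opens X) (VT : V `<=` opensT X) i m,
  f VT (part (mgr F V) i m) = part (mgr (dsum L) V) i (f VT m).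
Hypothesis f_res : forall (U V : opens X) (UT : U `<=` opensT X)
  (VT : V `<=` opensT X) (VU : V `<=` U) m, f VT (mres VU m) = mres VU (f UT m).
Hypothesis f_bij : forall (V : opens X) (VT : V `<=` opensT X), bijective (f VT).

Lemma mres0 (U V : opens X) (VU : V `<=` U) (G : superMod X) :
  mres VU (0 : msec G U) = 0.
Proof. by have := mresD VU (0 : msec G U) 0; rewrite addr0 -[X in X = _]addr0 => /addrI. Qed.

Definition only (V : opens X) (k : I) (s : msec (dsum L) V) : msec (dsum L) V :=
  fun l => if l == k then s l else 0.

Lemma onlyZD (V : opens X) k a (s t : msec (dsum L) V) :
  only k (a *: s + t) = a *: only k s + only k t.
Proof.
apply: functional_extensionality_dep => l; rewrite /only.
have E (u v : msec (dsum L) V) : (a *: u + v) l = a *: u l + v l by [].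
by rewrite !E; case: eqP => // _; rewrite scaler0 addr0.
Qed.

Lemma only_part (V : opens X) k i (s : msec (dsum L) V) :
  only k (part (mgr (dsum L) V) i s) = part (mgr (dsum L) V) i (only k s).
Proof.
apply: functional_extensionality_dep => l; rewrite /only /=.
by case: eqP => // _; rewrite part0.
Qed.

Lemma only_res (U V : opens X) (VU : V `<=` U) k (s : msec (dsum L) U) :
  only k (mres VU s) = mres VU (only k s).
Proof.
apply: functional_extensionality_dep => l; rewrite /only /=.
by case: eqP => // _; rewrite mres0.
Qed.

Lemma only_only (V : opens X) k (s : msec (dsum L) V) : only k (only k s) = only k s.
Proof. by apply: functional_extensionality_dep => l; rewrite /only; case: eqP. Qed.

(** The idempotent [only k] transported along [f]; bijectivity only asserts that a preimage exists,
    so one is chosen by [cid]. *)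
Definition summand_proj (k : I) (V : opens X) (m : msec F V) : msec F V :=
  sval (cid (let: Bijective g _ gK := f_bij (@subsetT _ V) in
             ex_intro _ (g (only k (f (@subsetT _ V) m))) (gK _)
             : exists n, f (@subsetT _ V) n = only k (f (@subsetT _ V) m))).

Lemma summand_projE k (V : opens X) (VT : V `<=` opensT X) (m : msec F V) :
  f VT (summand_proj k m) = only k (f VT m).
Proof.
rewrite (Prop_irrelevance VT (@subsetT _ V)) /summand_proj.
by case: cid.
Qed.

Lemma summand_projZD k (V : opens X) a (m n : msec F V) :
  summand_proj k (a *: m + n) = a *: summand_proj k m + summand_proj k n.
Proof.
apply: (bij_inj (f_bij (@subsetT _ V))).
by rewrite f_lin !summand_projE f_lin onlyZD.
Qed.

Lemma summand_proj_part k (V : opens X) i (m : msec F V) :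
  summand_proj k (part (mgr F V) i m) = part (mgr F V) i (summand_proj k m).
Proof.
apply: (bij_inj (f_bij (@subsetT _ V))).
by rewrite f_part !summand_projE f_part only_part.
Qed.

Lemma summand_proj_res k (U V : opens X) (VU : V `<=` U) (m : msec F U) :
  summand_proj k (mres VU m) = mres VU (summand_proj k m).
Proof.
apply: (bij_inj (f_bij (@subsetT _ V))).
by rewrite (f_res (@subsetT _ U)) !summand_projE (f_res (@subsetT _ U)) only_res.
Qed.

Lemma summand_proj_idem k (V : opens X) (m : msec F V) :
  summand_proj k (summand_proj k m) = summand_proj k m.
Proof.
by apply: (bij_inj (f_bij (@subsetT _ V))); rewrite !summand_projE only_only.
Qed.

Lemma summand_proj_eq0 (V : opens X) (VT : V `<=` opensT X) (m : msec F V) :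
  (forall k, summand_proj k m = 0) -> m = 0.
Proof.
move=> m0; apply: (bij_inj (f_bij VT)); rewrite (iso0 f_lin).
apply: functional_extensionality_dep => k.
have := congr1 (fun s : msec (dsum L) V => s k) (summand_projE k VT m).
by rewrite m0 (iso0 f_lin) /only eqxx.
Qed.

Lemma summand_coord_eq0 k (V : opens X) (VT : V `<=` opensT X) (m : msec F V) :
  f VT m k = 0 -> summand_proj k m = 0.
Proof.
move=> m0; apply: (bij_inj (f_bij VT)); rewrite (iso0 f_lin) summand_projE.
by apply: functional_extensionality_dep => l; rewrite /only; case: eqP => // ->.
Qed.

End SummandProjection.

(** * Line bundles near a point *)

Section RankOne.
Variables (K : fieldType) (X : superSpace K).

(** What is retained of local triviality: injective O-linear maps to O that shift parity by [sh],
    which treats even and odd line bundles together. *)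
Definition rank1_chart (sh : bool) (W : opens X) (L : superMod X) : Prop :=
  forall V : opens X, V `<=` W -> exists psi : msec L V -> sec V,
  [/\ forall a m n, psi (a *: m + n) = a * psi m + psi n,
      forall k m, psi (part (mgr L V) k m) = part (sgr V) (sh (+) k) (psi m) &
      forall m, psi m = 0 -> m = 0].

Lemma bundle10_chart (L : superMod X) (P : X) : even_line_bundle L ->
  exists2 W : opens X, oset W P & rank1_chart false W L.
Proof.
move=> /(_ P)[W WP [h [h1 h2 h3 h4]]]; exists W => // V VW.
exists (fun m => h V VW m (inl ord0)); split.
- by move=> a m n; rewrite h1.
- by move=> k m; rewrite h2.
move=> m m0; apply: (bij_inj (h4 V VW)); rewrite (iso0 h1).
by apply: functional_extensionality_dep => -[k|[]//]; rewrite (ord1 k).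
Qed.

Lemma bundle01_chart (L : superMod X) (P : X) : odd_line_bundle L ->
  exists2 W : opens X, oset W P & rank1_chart true W L.
Proof.
move=> /(_ P)[W WP [h [h1 h2 h3 h4]]]; exists W => // V VW.
exists (fun m => h V VW m (inr ord0)); split.
- by move=> a m n; rewrite h1.
- by move=> k m; rewrite h2.
move=> m m0; apply: (bij_inj (h4 V VW)); rewrite (iso0 h1).
by apply: functional_extensionality_dep => -[[]//|k]; rewrite (ord1 k).
Qed.

End RankOne.

(** * Nonexistence of a splitting *)

Section NoSplitting.
Variable K : closedFieldType.
Notation X := (P11 K).
Implicit Types U V W : opens X.

(* sh = false for an embedding into O, sh = true for one into Pi O. *)
Lemma no_rank1_embedding i V (Vi : V `<=` chart K i) (sh : bool)
    (phi : superder V -> sec V) : oset V (genPt K) ->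
  (forall a D E, phi (a *: D + E) = a * phi D + phi E) ->
  (forall k D, phi (part (der_grading V) k D) = part (sgr V) (sh (+) k) (phi D)) ->
  ~ (forall D, phi D = 0 -> D = 0).
Proof.
move=> Vg lin par inj; pose VV := @subset_refl _ V.
(* The frame field whose image under [phi] is odd, with the coordinate on which it takes the value
   1. *)
pose D := if sh then der_z i V else der_zeta i V.
pose x := if sh then coord_z Vi else coord_zeta Vi.
have Dx : der_op D VV x = 1.
  by rewrite /D /x; case: (sh); [apply: der_z_z | apply: der_zeta_zeta].
have Dsh : pure (der_grading V) (~~ sh) D.
  by rewrite /D; case: (sh); [apply: der_z_pure | apply: der_zeta_pure].
have /gval_pure phiD : pure (sgr V) true (phi D).
  by rewrite -Dsh par addbN addbb; apply: pure_part.
have phi0 : phi 0 = 0.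
  by have := lin 1 0 0; rewrite scale1r mul1r addr0 -[X in X = _]addr0 => /addrI.
(* Both zeta and [phi D] are multiples of theta, so [phi] kills zeta D. *)
have : coord_zeta Vi *: D = 0.
  apply: inj; rewrite -[_ *: _]addr0 lin phi0 addr0; apply: gval_inj => _.
  by rewrite gvalM -phiD gval_coord_zeta // gval0; apply: gr_eq; rewrite /= ?mul0r ?mulr0 ?addr0.
move/(congr1 (fun E => gval (der_op E VV x))).
rewrite der_opZ Dx mulr1 res_id gval_coord_zeta // gval0 => -[/eqP].
by rewrite invr_eq0 (negPf (tofracX_neq0 _ _)).
Qed.

Lemma tangent_not_split : ~ splits_as_line_bundles (tangent X).
Proof.
move=> [p [q [L [M [hL hM [f [f1 f2 f3 f4]]]]]]].
set N := fun k : 'I_p + 'I_q => match k with inl l => L l | inr l => M l end in f f1 f2 f3 f4.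
have N_chart k : exists W sh, oset W (genPt K) /\ rank1_chart sh W (N k).
  case: k => l.
    by have [W Wg h] := @bundle10_chart _ X _ (genPt K) (hL l); exists W, false.
  by have [W Wg h] := @bundle01_chart _ X _ (genPt K) (hM l); exists W, true.
pose i : 'I_2 := ord0; pose U := chart K i; pose UU := @subset_refl _ U.
pose e k V (D : superder V) : superder V := summand_proj (F := tangent X) f4 k D.
have e_dich k : (forall V (VU : V `<=` U) (D : superder V), e k V D = 0) \/
    (forall V (VU : V `<=` U) (D : superder V), e k V D = D).
  apply: idempotent_endo_trivial.
  - by move=> V a D E; apply: (summand_projZD f1).
  - by move=> V j D; apply: (summand_proj_part f2).
  - by move=> V V' VV' D; apply: (summand_proj_res f3).
  - by move=> V D; apply: (summand_proj_idem f4).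
(* If every projection vanished on the chart, so would all components of d/dz. *)
have [k ek] : exists k, forall V (VU : V `<=` U) (D : superder V), e k V D = D.
  apply: contrapT => no_k.
  have z0 : der_z i U = 0.
    apply: (summand_proj_eq0 f1 (f_bij := f4) (@subsetT _ U)) => k.
    have [ek|ek] := e_dich k; first exact: ek.
    by case: no_k; exists k.
  have := der_z_z UU UU; rewrite z0 => /(congr1 (@gval _ _)).
  by rewrite gval0 gval1; [case=> /esym/eqP; rewrite oner_eq0 | apply: genPt_chart].
have [W [sh [Wg chN]]] := N_chart k.
(* On V the k-th projection is the identity and the k-th summand embeds in O or Pi O; V is nonempty
   because both sets contain the generic point. *)
pose V := opensI W U; pose VT := @subsetT _ V.
have VW : V `<=` W by apply: subIsetl.
have VU : V `<=` U by apply: subIsetr.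
have [psi [psi1 psi2 psi3]] := chN V VW.
pose phi (D : superder V) : sec V := psi (f V VT D k).
apply: (@no_rank1_embedding i V VU sh phi).
- by split=> //; apply: genPt_chart.
- by move=> a D E; rewrite /phi -psi1 f1.
- by move=> l D; rewrite /phi -psi2 f2.
(* As the projection is the identity here, a section with zero k-th component is zero. *)
move=> D /psi3 fD0; rewrite -(ek V VU D).
exact: (summand_coord_eq0 f1 f4 fD0).
Qed.

End NoSplitting.

Theorem mainTheorem2 (K : closedFieldType) (hK : [pchar K]%R =i pred0) :
  is_bundle 1 1 (tangent (P11 K)) /\
  ~ splits_as_line_bundles (tangent (P11 K)).
Proof. by split; [apply: tangent_bundle | apply: tangent_not_split]. Qed.
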